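(* Let $(\mathcal G,\lambda,\mu)$ be a measure semigroupoid. If $(\mathcal G,\lambda,\mu)$ is Reiter, then it is Liouville.
   Context: A semigroupoid is a small category: a set $\mathcal G$ of morphisms, a set $\mathcal G^{(0)}$ of objects (units), surjective source and target maps $\mathbf s,\mathbf t:\mathcal G\to\mathcal G^{(0)}$, and a composition $(\zeta,\eta)\mapsto\zeta\eta$ defined on $\mathcal G^{(2)}=\{(\zeta,\eta)\in\mathcal G^2:\mathbf s(\zeta)=\mathbf t(\eta)\}$. Units are identified with identity morphisms, so $\mathcal G^{(0)}\subseteq\mathcal G$. For $x\in\mathcal G^{(0)}$ put $\mathcal G^x=\mathbf t^{-1}(x)$. An analytic Borel space is a measurable space isomorphic to an analytic subset (continuous image of a Polish space) of a Polish space with the relative Borel structure. A Borel semigroupoid is a semigroupoid $\mathcal G$ such that $\mathcal G$ is an analytic Borel space, $\mathcal G^{(0)}$ is an analytic Borel space as a subspace of $\mathcal G$, and $\mathbf s$, $\mathbf t$ and the composition are Borel. A Borel system of measures on $\mathcal G$ is a family $\lambda=(\lambda^x)_{x\in\mathcal G^{(0)}}$ of $\sigma$-finite positive Borel measures $\lambda^x$ on $\mathcal G^x$ (regarded also as measures on $\mathcal G$ vanishing outside $\mathcal G^x$) such that $x\mapsto\int_{\mathcal G}f\,d\lambda^x\in[0,\infty]$ is Borel for every non-negative Borel function $f$ on $\mathcal G$. For $\gamma\in\mathcal G$ and a measure $\rho$ on $\mathcal G^{\mathbf s(\gamma)}$, $\gamma\rho$ denotes the pushforward of $\rho$ under $\mathcal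 G^{\mathbf s(\gamma)}\to\mathcal G^{\mathbf t(\gamma)}$, $\eta\mapsto\gamma\eta$. Write $\nu_1\prec\nu_2$ for absolute continuity of $\nu_1$ with respect to $\nu_2$. A quasi-Haar system on $\mathcal G$ is a Borel system of measures $\lambda$ such that $\gamma\lambda^{\mathbf s(\gamma)}\prec\lambda^{\mathbf t(\gamma)}$ for all $\gamma\in\mathcal G$ and $(\gamma,\eta)\in\mathcal G^2\mapsto\frac{d(\gamma\lambda^{\mathbf s(\gamma)})}{d\lambda^{\mathbf t(\gamma)}}(\eta)\in[0,\infty]$ is Borel. A Borel system $\lambda$ is proper if there is an increasing sequence of Borel sets $A_n$ with $\mathcal G=\bigcup_nA_n$ such that for each $n$ the map $x\mapsto\lambda^x(A_n)\in\mathbb R$ is bounded. A measure semigroupoid is a triple $(\mathcal G,\lambda,\mu)$ with $\mathcal G$ a Borel semigroupoid, $\lambda$ a proper quasi-Haar system on $\mathcal G$ and $\mu$ a positive Borel measure on $\mathcal G^{(0)}$. A Borel system $\theta=(\theta^x)_{x\in\mathcal G^{(0)}}$ of probability measures $\theta^x$ on $\mathcal G^x$ is $\lambda$-adapted if $\theta^x\prec\lambda^x$ for every $x$ and $(\gamma,\eta)\in\mathcal G^2\mapsto\frac{d(\gamma\theta^{\mathbf s(\gamma)})}{d\lambda^{\mathbf t(\gamma)}}(\eta)\in[0,\infty]$ is Borel. The measure $\mu\star\lambda$ on $\mathcal G$ is $(\mu\star\lambda)(E)=\int_{\mathcal G^{(0)}}\lambda^x(E)\,d\mu(x)$. $\|\cdot\|$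 is the total variation norm. $(\mathcal G,\lambda,\mu)$ is Reiter if there is a sequence $(\theta_n)_n$ of $\lambda$-adapted Borel systems of probability measures $\theta_n=(\theta_n^x)_x$ such that $\lim_{n\to\infty}\int_{\mathcal G}\|\theta_n^{\mathbf t(\gamma)}-\gamma\theta_n^{\mathbf s(\gamma)}\|f(\gamma)\,d(\mu\star\lambda)(\gamma)=0$ for all $f\in L^1(\mathcal G,\mu\star\lambda)$. For a $\lambda$-adapted Borel system of probability measures $\pi=(\pi_x)_x$, define $P_x:L^\infty(\mathcal G^x,\lambda^x)\to L^\infty(\mathcal G^x,\lambda^x)$ by $P_x(f)(\zeta)=\int_{\mathcal G^{\mathbf s(\zeta)}}f(\zeta\eta)\,d\pi_{\mathbf s(\zeta)}(\eta)$, and $H_{\pi,x}(\mathcal G)=\{f\in L^\infty(\mathcal G^x,\lambda^x):P_x(f)=f\}$. $(\mathcal G,\lambda,\mu)$ is Liouville if there is a $\lambda$-adapted Borel system of probability measures $\pi$ with $H_{\pi,x}(\mathcal G)=\mathbb C\mathbf 1$ (the constants) for $\mu$-a.e. $x\in\mathcal G^{(0)}$.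
   Formalization: The measure μ on the unit space is assumed σ-finite; without this the claim fails, e.g. for the free group F_2 with counting measure and μ = ∞ times the point mass, which is vacuously Reiter but not Liouville. *)

(* Defs.v *)
From HB Require Import structures.
From mathcomp Require Import all_boot all_order all_algebra complex.
From mathcomp Require Import all_classical all_reals all_analysis measurable_realfun.

Set Implicit Arguments.
Unset Strict Implicit.
Unset Printing Implicit Defensive.

Import Order.TTheory GRing.Theory Num.Theory.
Import numFieldNormedType.Exports.

Local Open Scope classical_set_scope.
Local Open Scope ring_scope.
Local Open Scope ereal_scope.
Local Open Scope complex_scope.

(* A Hausdorff space with a complete pseudometric structure is completely
   metrizable; the library has no join of metricType and completeType. *)
Definition polish (R : realType) (X : completePseudoMetricType R) : Prop :=
  hausdorff_space X /\ exists2 D : set X, countable D & dense D.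

Definition analytic_set (R : realType) (Y : topologicalType) (A : set Y)
    : Prop :=
  exists (Z : completePseudoMetricType R) (f : Z -> Y),
    [/\ polish Z, continuous f & range f = A].

(* T is isomorphic, via phi, to its image with the relative Borel structure. *)
Definition analytic_borel (R : realType) (d : measure_display)
    (T : measurableType d) : Prop :=
  exists (Y : completePseudoMetricType R) (phi : T -> Y),
    [/\ polish Y, analytic_set R (range phi), injective phi &
        @measurable d T =
          preimage_set_system setT phi <<s [set U : set Y | open U] >>].

(* G0 is the set of objects and G the set of morphisms; idm embeds G0 into G as
   the units. The value of comp_mor z e is only meaningful if src z = tgt e. *)
Record semigroupoid (G0 G : Type) := Semigroupoid {
  idm : G0 -> G ;
  src : G -> G0 ;
  tgt : G -> G0 ;
  comp_mor : G -> G -> G ;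
  src_idm : forall x, src (idm x) = x ;
  tgt_idm : forall x, tgt (idm x) = x ;
  src_comp : forall z e, src z = tgt e -> src (comp_mor z e) = src e ;
  tgt_comp : forall z e, src z = tgt e -> tgt (comp_mor z e) = tgt z ;
  compA : forall z e c, src z = tgt e -> src e = tgt c ->
    comp_mor (comp_mor z e) c = comp_mor z (comp_mor e c) ;
  comp_idl : forall z, comp_mor (idm (tgt z)) z = z ;
  comp_idr : forall z, comp_mor z (idm (src z)) = z }.

Definition composable (G0 G : Type) (S : semigroupoid G0 G) : set (G * G) :=
  [set p | src S p.1 = tgt S p.2].

Definition fiber (G0 G : Type) (S : semigroupoid G0 G) (x : G0) : set G :=
  tgt S @^-1` [set x].

Record borel_semigroupoid (R : realType) (d0 d : measure_display)
    (G0 : measurableType d0) (G : measurableType d) := BorelSemigroupoid {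
  bs_semigroupoid :> semigroupoid G0 G ;
  bs_analytic : analytic_borel R G ;
  bs_analytic0 : analytic_borel R G0 ;
  bs_subspace : @measurable d0 G0 =
    preimage_set_system setT (idm bs_semigroupoid) (@measurable d G) ;
  bs_src : measurable_fun setT (src bs_semigroupoid) ;
  bs_tgt : measurable_fun setT (tgt bs_semigroupoid) ;
  (* measurability for the relative structure on the composable pairs *)
  bs_comp : forall E : set G, measurable E ->
    exists2 B : set (G * G), measurable B &
      composable bs_semigroupoid `&`
        (fun p => comp_mor bs_semigroupoid p.1 p.2) @^-1` E =
      composable bs_semigroupoid `&` B }.

Lemma measurable_set1_analytic (R : realType) (d : measure_display)
    (T : measurableType d) (x : T) : analytic_borel R T -> measurable [set x].
Proof.
move=> [Y [phi [[hY _] _ phiI ->]]]; exists [set phi x].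
  rewrite -(setCK [set phi x]); apply: sigma_algebraC.
  apply: sub_sigma_algebra; apply: closed_openC.
  exact: accessible_closed_set1 (hausdorff_accessible hY) _.
by rewrite setTI; apply/seteqP; split => y /= => [/phiI|->].
Qed.

Lemma measurable_fiber (R : realType) (d0 d : measure_display)
    (G0 : measurableType d0) (G : measurableType d)
    (S : borel_semigroupoid R G0 G) (x : G0) : measurable (fiber S x).
Proof.
rewrite -[fiber S x]setTI; apply: bs_tgt => //.
exact: measurable_set1_analytic (bs_analytic0 S).
Qed.

Section systems.
Context (R : realType) (d0 d : measure_display).
Context (G0 : measurableType d0) (G : measurableType d).

Record borel_system (S : semigroupoid G0 G) := BorelSystem {
  sys_measure :> G0 -> {measure set G -> \bar R} ;
  sys_sigma_finite : forall x, sigma_finite setT (sys_measure x) ;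
  sys_fiber : forall x, sys_measure x (~` fiber S x) = 0 ;
  sys_borel : forall f : G -> \bar R, measurable_fun setT f ->
    (forall g, 0 <= f g) ->
    measurable_fun setT (fun x => \int[sys_measure x]_g f g) }.

(* The push-forward of rho under the map e |-> comp_mor g e, defined on the fiber
   over src g only. *)
Definition translate (S : semigroupoid G0 G) (g : G)
    (rho : set G -> \bar R) : set G -> \bar R :=
  fun E => rho (fiber S (src S g) `&` comp_mor S g @^-1` E).

(* For each g the Radon-Nikodym derivative is only determined up to a null set:
   the requirement is that versions can be chosen to be jointly Borel. *)
Definition jointly_borel_derivative (nu : G -> set G -> \bar R)
    (m : G -> {measure set G -> \bar R}) : Prop :=
  exists D : G * G -> \bar R,
    [/\ measurable_fun setT D, forall p, 0 <= D p &
        forall g E, measurable E -> nu g E = \int[m g]_(e in E) D (g, e)].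

Definition quasi_haar (S : semigroupoid G0 G) (lam : borel_system S) : Prop :=
  (forall g, translate S g (lam (src S g)) `<< lam (tgt S g)) /\
  jointly_borel_derivative (fun g => translate S g (lam (src S g)))
    (fun g => lam (tgt S g)).

Definition proper_system (S : semigroupoid G0 G) (lam : borel_system S) : Prop :=
  exists A : (set G)^nat,
    [/\ forall n, measurable (A n), forall n, A n `<=` A n.+1,
        \bigcup_n A n = setT &
        forall n, exists M : R, forall x, lam x (A n) <= M%:E].

Definition adapted_probability (S : semigroupoid G0 G)
    (lam theta : borel_system S) : Prop :=
  [/\ forall x, theta x setT = 1,
      forall x, theta x `<< lam x &
      jointly_borel_derivative (fun g => translate S g (theta (src S g)))
        (fun g => lam (tgt S g))].

Definition mstar (mu : {measure set G0 -> \bar R}) (S : semigroupoid G0 G)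
    (lam : borel_system S) : set G -> \bar R :=
  fun E => \int[mu]_x lam x E.

Section mstar_measure.
Variables (mu : {measure set G0 -> \bar R}) (S : semigroupoid G0 G).
Variable lam : borel_system S.

Lemma sys_measurable (E : set G) : measurable E ->
  measurable_fun setT (fun x => lam x E).
Proof.
move=> mE; rewrite (_ : (fun x => _) = (fun x => \int[lam x]_g (\1_E g)%:E)).
  apply: sys_borel; last by move=> g; rewrite lee_fin.
  by apply/measurable_EFinP; exact: measurable_indic.
by apply/funext => x; rewrite integral_indic// setIT.
Qed.

Let mstar0 : mstar mu lam set0 = 0.
Proof. by rewrite /mstar integral0_eq. Qed.

Let mstar_ge0 E : 0 <= mstar mu lam E.
Proof. by apply: integral_ge0 => x _; exact: measure_ge0. Qed.

Let mstar_sigma_additive : semi_sigma_additive (mstar mu lam).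
Proof.
move=> F mF tF mUF; rewrite [X in _ --> X](_ : _ =
    \sum_(n <oo) mstar mu lam (F n)).
  by apply: is_cvg_nneseries => n _ _; exact: mstar_ge0.
rewrite /mstar -integral_nneseries//; last first.
  by move=> n; exact: sys_measurable.
by apply: eq_integral => x _; rewrite measure_semi_bigcup.
Qed.

HB.instance Definition _ := isMeasure.Build d G R (mstar mu lam)
  mstar0 mstar_ge0 mstar_sigma_additive.

End mstar_measure.

End systems.

Record measure_semigroupoid (R : realType) (d0 d : measure_display)
    (G0 : measurableType d0) (G : measurableType d) := MeasureSemigroupoid {
  ms_semigroupoid :> borel_semigroupoid R G0 G ;
  ms_lambda : borel_system R ms_semigroupoid ;
  ms_mu : {measure set G0 -> \bar R} ;
  ms_quasi_haar : quasi_haar ms_lambda ;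
  ms_proper : proper_system ms_lambda }.

Section complex_functions.
Context (R : realType) (d : measure_display) (T : measurableType d).
Implicit Types (m : {measure set T -> \bar R}) (D : set T) (f : T -> R[i]).

Definition cmeasurable D f : Prop :=
  measurable_fun D (fun t => complex.Re (f t)) /\
  measurable_fun D (fun t => complex.Im (f t)).

Definition cintegrable m D f : Prop :=
  m.-integrable D (fun t => (complex.Re (f t))%:E) /\
  m.-integrable D (fun t => (complex.Im (f t))%:E).

Definition cintegral m D f : R[i] :=
  (\int[m]_(t in D) complex.Re (f t))%R +i*
  (\int[m]_(t in D) complex.Im (f t))%R.

Definition total_variation_norm (nu : set T -> \bar R) : \bar R :=
  ereal_sup [set r | exists (n : nat) (E : 'I_n -> set T),
    [/\ forall i, measurable (E i), trivIset setT E, \bigcup_i E i = setT &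
        r = \sum_(i < n) `|nu (E i)|]].

End complex_functions.

Section reiter_liouville.
Context (R : realType) (d0 d : measure_display).
Context (G0 : measurableType d0) (G : measurableType d).
Implicit Type M : measure_semigroupoid R G0 G.

(* The norm is at most 2 when theta consists of probabilities, so that fine
   loses nothing. *)
Definition translation_defect M (theta : borel_system R M) (g : G) : R :=
  fine (total_variation_norm
    (fun E => theta (tgt M g) E - translate M g (theta (src M g)) E)).

Definition reiter M : Prop :=
  exists theta : nat -> borel_system R M,
    (forall n, adapted_probability (ms_lambda M) (theta n)) /\
    forall f : G -> R[i],
      cintegrable (mstar (ms_mu M) (ms_lambda M)) setT f ->
      (fun n => cintegral (mstar (ms_mu M) (ms_lambda M)) setT
         (fun g => ((translation_defect (theta n) g)%:C * f g)%R) : R[i]^o)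
        @ \oo --> (0%R : R[i]^o).

(* Elements of L^oo(G^x, lam^x) are represented by functions on G, of which only
   the restriction to G^x matters, and are compared lam^x-almost everywhere. *)
Definition Linfty M (x : G0) : set (G -> R[i]) :=
  [set f | cmeasurable (fiber M x) f /\
    exists C : R, {ae ms_lambda M x, forall z, (`|f z| <= C%:C)%R}].

Definition markov_operator M (pi : borel_system R M) (f : G -> R[i]) (z : G)
    : R[i] :=
  cintegral (pi (src M z)) (fiber M (src M z)) (fun e => f (comp_mor M z e)).

Definition harmonic_functions M (pi : borel_system R M) (x : G0) : set (G -> R[i]) :=
  [set f | Linfty M x f /\
    {ae ms_lambda M x, forall z, markov_operator pi f z = f z}].

Definition constant_functions M (x : G0) : set (G -> R[i]) :=
  [set f | Linfty M x f /\
    exists c : R[i], {ae ms_lambda M x, forall z, f z = c}].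

Definition liouville M : Prop :=
  exists pi : borel_system R M, adapted_probability (ms_lambda M) pi /\
    {ae ms_mu M, forall x, harmonic_functions pi x = constant_functions M x}.

End reiter_liouville.

(* Main.v *)
From HB Require Import structures.
Require Import Defs.
From mathcomp Require Import all_boot all_order all_algebra complex.
From mathcomp Require Import all_classical all_reals all_analysis measurable_realfun.
From mathcomp Require Import lra.

(** The Liouville system is a convex combination pi = sum_k t_k theta_(sigma k)
    of members of a Reiter sequence, as in the argument of Kaimanovich and
    Vershik for amenable groups; everything lies in a fast enough choice of
    sigma.

    For a morphism z let K_k z be the translate z theta_(sigma k)^(s z), a
    probability on the fibre of t z.  If v has values in [0, B] and is
    pi-harmonic on that fibre, then v = sum_k t_k K_k v there.  Fix m, write this sum as
    Q + T where Q collects the indices below m, and let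
    tau = t_0 + ... + t_(m-1) < 1.  Iterating v = Qv + Tv gives
    v = Q^n v + sum_(j < n) Q^j (Tv).  The first term is at most B tau^n.  In
    Tv each K_k v differs by at most B times the excess of K_k z over
    theta_(sigma k)^(t z) from the integral of v against theta_(sigma k)^(t z),
    which does not depend on the point z of the fibre; and Q multiplies a
    constant of the fibre by tau.  So v(z) differs from a number that depends on
    the fibre only by at most B (tau^n + U_m z), where
    U_m = sum_(j < n) Q^j (sum_(k >= m) t_k excess_k): this is
    [oscillation_bound].  If n = n_m is chosen with tau^n -> 0, it remains to
    have U_m -> 0 almost everywhere, and then v is constant on almost every
    fibre ([oscillation_limit], [harmonic_ae_constant]).

    Reiter's condition says that the excesses tend to 0 in L^1 on sets of finite
    measure ([reiter_excess_cvg0]).  Along a subsequence they tend to 0 almost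
    everywhere, and the operators involved preserve this because K_k z is
    absolutely continuous with respect to lambda^(t z) ([potential_ae_cvg0]).
    Now Q and n_m only involve sigma_0, ..., sigma_(m-1), so that sigma_k can be
    chosen, knowing its predecessors, to make the contributions of excess_k to
    U_0, ..., U_k as small as desired; this is [potential_selection].

    Measurability rests on the joint densities of an adapted system: they exhibit
    the excess as the integral over the set where one density dominates the
    other, hence as a Borel function ([measurable_excess]), and the identity
    morphisms provide the density of theta^x itself
    ([joint_density_exists]). *)

Set Implicit Arguments.
Unset Strict Implicit.
Unset Printing Implicit Defensive.

Import Order.TTheory GRing.Theory Num.Theory.
Import numFieldNormedType.Exports.

Local Open Scope classical_set_scope.
Local Open Scope ring_scope.
Local Open Scope ereal_scope.

(** * Integration lemmas *)

Lemma bounded_integrable (R : realType) (d : measure_display)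
  (T : measurableType d) (m : {measure set T -> \bar R}) (f : T -> R) (B : R) :
  m setT < +oo -> measurable_fun setT f -> (forall x, `|f x| <= B)%R ->
  m.-integrable setT (EFin \o f).
Proof.
move=> moo mf fB; apply: measurable_bounded_integrable => //.
exists B; split; first exact: num_real.
by move=> L BL x _; exact: le_trans (fB x) (ltW BL).
Qed.

Section restricted_integral.
Context (R : realType) (d : measure_display) (T : measurableType d).
Implicit Types (m : {measure set T -> \bar R}) (D : set T) (f : T -> \bar R).

Lemma ge0_integral_mrestr m D (mD : measurable D) f :
  (forall x, 0 <= f x) -> measurable_fun setT f ->
  \int[mrestr m mD]_x f x = \int[m]_(x in D) f x.
Proof.
move=> f0 mf; rewrite [LHS](ge0_negligible_integral (N := ~` D))//.
- rewrite setTD setCK; apply: eq_measure_integral => E mE ED.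
  by rewrite /= /mrestr setIidl.
- exact: measurableC.
- by rewrite /= /mrestr setICl measure0.
Qed.

Lemma ge0_le_measure_integral_on m1 m2 D f : measurable D ->
  (forall E, measurable E -> E `<=` D -> m1 E <= m2 E) ->
  (forall x, 0 <= f x) -> measurable_fun setT f ->
  \int[m1]_(x in D) f x <= \int[m2]_(x in D) f x.
Proof.
move=> mD m12 f0 mf; rewrite -!(ge0_integral_mrestr _ mD)//.
apply: ge0_le_measure_integral => // E mE.
by apply: m12 => //; exact: measurableI.
Qed.

(** Here H is the positive half of a Hahn decomposition of P - Q.  On H compare
    the integrals of B - f, on the complement those of f. *)
Lemma integral_hahn_le (P Q : {measure set T -> \bar R}) (H : set T) (B : R) f :
  measurable H -> P H < +oo -> Q H < +oo ->
  (forall E, measurable E -> E `<=` H -> Q E <= P E) ->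
  (forall E, measurable E -> E `<=` ~` H -> P E <= Q E) ->
  (forall x, 0 <= f x <= B%:E) -> measurable_fun setT f ->
  \int[P]_x f x <= \int[Q]_x f x + B%:E * (P H - Q H).
Proof.
move=> mH PH QH QP PQ fB mf.
have f0 x : 0 <= f x by case/andP: (fB x).
have mHC : measurable (~` H) by exact: measurableC.
have ffin x : f x \is a fin_num.
  by rewrite ge0_fin_numE// (le_lt_trans (andP (fB x)).2)// ltry.
have mfH : measurable_fun H f by exact: measurable_funTS.
have g0 x : 0 <= B%:E - f x by rewrite sube_ge0 ?(andP (fB x)).2// ffin.
have mg : measurable_fun setT (fun x => B%:E - f x) by exact: emeasurable_funB.
have fg (m : {measure set T -> \bar R}) :
    \int[m]_(x in H) f x + \int[m]_(x in H) (B%:E - f x) = B%:E * m H.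
  rewrite -integral_cst// -ge0_integralD//; last exact: measurable_funTS.
  by apply: eq_integral => x _; rewrite addeC subeK.
have splitH (m : {measure set T -> \bar R}) :
    \int[m]_x f x = \int[m]_(x in H) f x + \int[m]_(x in ~` H) f x.
  rewrite -ge0_integral_setU ?setUv//.
  by apply/disj_setPS; rewrite setICr.
have B0 : (forall m : {measure set T -> \bar R}, m H < +oo ->
    \int[m]_(x in H) f x \is a fin_num /\
    \int[m]_(x in H) (B%:E - f x) \is a fin_num).
  move=> m mHoo; have := fg m.
  have : B%:E * m H \is a fin_num by rewrite fin_numM// ge0_fin_numE.
  move=> + E; rewrite -E fin_numD => /andP[-> ->] //.
have [fP gP] := B0 P PH; have [fQ gQ] := B0 Q QH.
have PHf : P H \is a fin_num by rewrite ge0_fin_numE.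
have QHf : Q H \is a fin_num by rewrite ge0_fin_numE.
rewrite !splitH (addeAC (\int[Q]_(x in H) f x)); apply: leeD; last first.
  exact: ge0_le_measure_integral_on.
rewrite muleBr ?fin_num_adde_defr// ?fin_numM//.
rewrite -(fg P) -(fg Q).
have := ge0_le_measure_integral_on mH QP g0 mg.
rewrite -(fineK fP) -(fineK gP) -(fineK fQ) -(fineK gQ) lee_fin => gQP.
by rewrite -!EFinD lee_fin; lra.
Qed.

(** The integral of a nonnegative function is a supremum over simple functions
    below it, which is monotone whether or not the functions are measurable.
    This allows comparisons with the translation defect, a supremum over
    uncountably many partitions. *)
Lemma ge0_le_integral_nonmeasurable m (f g : T -> \bar R) :
  (forall x, 0 <= f x) -> (forall x, f x <= g x) ->
  \int[m]_x f x <= \int[m]_x g x.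
Proof.
move=> f0 fg; have g0 x : 0 <= g x by exact: le_trans (fg x).
rewrite !ge0_integralTE//; apply: le_ereal_sup => _ [h /= hf <-].
by exists h => //= x; exact: le_trans (hf x) (fg x).
Qed.

End restricted_integral.

Section exhausted_kernel.
Context (R : realType) (d1 d2 : measure_display).
Context (X : measurableType d1) (Y : measurableType d2).
Variables (kappa : X -> {measure set Y -> \bar R}) (A : nat -> set Y).
Hypothesis measurable_kappa :
  forall E, measurable E -> measurable_fun setT (fun x => kappa x E).
Hypothesis mA : forall n, measurable (A n).
Hypothesis ndA : forall n, A n `<=` A n.+1.
Hypothesis A_cover : \bigcup_n A n = setT.
Hypothesis kappa_A : forall n, exists M : R, forall x, kappa x (A n) <= M%:E.

Let restr n x : {measure set Y -> \bar R} := mrestr (kappa x) (mA n).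

Let measurable_restr n E : measurable E ->
  measurable_fun setT (fun x => restr n x E).
Proof. by move=> mE; apply: measurable_kappa; exact: measurableI. Qed.

HB.instance Definition _ n :=
  isKernel.Build _ _ X Y R (restr n) (@measurable_restr n).

Let restr_uub n : measure_fam_uub (restr n).
Proof.
have [M MP] := kappa_A n; exists (M + 1)%R => x.
rewrite /restr/= /mrestr setTI; apply: le_lt_trans (MP x) _.
by rewrite lte_fin ltrDl.
Qed.

HB.instance Definition _ n :=
  Kernel_isFinite.Build _ _ X Y R (restr n) (restr_uub n).

(** The restrictions of kappa to the sets A n are finite kernels, for which the
    statement is known, and the integrals over A n increase to the full one. *)
Lemma measurable_fun_integral_exhausted (h : X * Y -> \bar R) :
  (forall p, 0 <= h p) -> measurable_fun setT h ->
  measurable_fun setT (fun x => \int[kappa x]_y h (x, y)).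
Proof.
move=> h0 mh.
apply: (emeasurable_fun_cvg (fun n x => \int[restr n x]_y h (x, y))).
  by move=> n; exact: (measurable_fun_integral_finite_kernel h (restr n)).
move=> x _; have mhx : measurable_fun setT (fun y => h (x, y)).
  exact: measurableT_comp.
rewrite -[in X in _ --> X]A_cover.
rewrite (_ : (fun n => _) = (fun n => \int[kappa x]_(y in A n) h (x, y))).
  apply: ge0_nondecreasing_set_cvg_integral => //.
  - by apply/nondecreasing_seqP => n; apply/subsetPset.
  - by move=> n; exact: measurable_funTS.
apply/funext => n; rewrite /restr ge0_integral_mrestr//.
Qed.

End exhausted_kernel.

(** * Mixtures of kernels and their potentials *)

Section mixture.
Context (R : realType) (d : measure_display) (T : measurableType d).
Variables (t : nat -> {nonneg R}) (K : nat -> T -> {measure set T -> \bar R}).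
Hypothesis measurable_K :
  forall k E, measurable E -> measurable_fun setT (fun z => K k z E).
Hypothesis K_total : forall k z, K k z setT = 1.

(** This is the operator Q of the argument sketched at the top. *)
Definition mixture (m : nat) (F : T -> \bar R) (z : T) : \bar R :=
  \sum_(k < m) (t k)%:num%:E * \int[K k z]_y F y.

Definition tail_mean (m : nat) (g : nat -> T -> \bar R) (z : T) : \bar R :=
  \sum_(m <= k <oo) (t k)%:num%:E * g k z.

(** The sum of the first n iterates Q^j F, defined by U_(n+1) = F + Q U_n. *)
Fixpoint potential (m n : nat) (F : T -> \bar R) : T -> \bar R :=
  if n is n'.+1 then fun z => F z + mixture m (potential m n' F) z
  else cst 0.

Section tail.
Variable g : nat -> T -> \bar R.
Hypothesis g_ge0 : forall k z, 0 <= g k z.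

Lemma tail_mean_ge0 m z : 0 <= tail_mean m g z.
Proof. by apply: nneseries_ge0 => k _ _; apply: mule_ge0; rewrite ?lee_fin. Qed.

Lemma measurable_tail_mean m : (forall k, measurable_fun setT (g k)) ->
  measurable_fun setT (tail_mean m g).
Proof.
move=> mg; rewrite (_ : tail_mean m g = (fun z =>
    \sum_(k <oo) (t (k + m)%N)%:num%:E * g (k + m)%N z)).
  apply: ge0_emeasurable_sum => [k z _ _|k _].
    by apply: mule_ge0; rewrite ?lee_fin.
  exact: measurable_funeM.
apply/funext => z.
rewrite /tail_mean -(@nneseries_addn _ (fun k => (t k)%:num%:E * g k z))//.
by move=> k; apply: mule_ge0; rewrite ?lee_fin.
Qed.

End tail.

Lemma mixture_ge0 m F z : (forall y, 0 <= F y) -> 0 <= mixture m F z.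
Proof.
move=> F0; apply: sume_ge0 => k _; apply: mule_ge0; first by rewrite lee_fin.
exact: integral_ge0.
Qed.

Lemma measurable_mixture m F : (forall y, 0 <= F y) -> measurable_fun setT F ->
  measurable_fun setT (mixture m F).
Proof.
move=> F0 mF; apply: emeasurable_sum => k; apply: measurable_funeM.
by apply: measurable_fun_integral_kernel => //; exact: measurable_K.
Qed.

Lemma potential_ge0 m n F z : (forall y, 0 <= F y) -> 0 <= potential m n F z.
Proof.
move=> F0; elim: n z => [|n IH] z //=; apply: adde_ge0 => //.
exact: mixture_ge0.
Qed.

Lemma measurable_potential m n F : (forall y, 0 <= F y) ->
  measurable_fun setT F -> measurable_fun setT (potential m n F).
Proof.
move=> F0 mF; elim: n => [|n IH] /=; first exact: measurable_cst.
apply: emeasurable_funD => //; apply: measurable_mixture => // y.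
exact: potential_ge0.
Qed.

Lemma mixture_le_cst m F (b : R) z : (forall y, 0 <= F y <= b%:E) ->
  measurable_fun setT F ->
  mixture m F z <= (\sum_(k < m) (t k)%:num)%R%:E * b%:E.
Proof.
move=> Fb mF; rewrite -sumEFin ge0_sume_distrl; last first.
  by move=> k _; rewrite lee_fin.
apply: lee_sum => k _; apply: lee_wpmul2l; first by rewrite lee_fin.
rewrite -[leRHS]mule1 -(K_total k z) -integral_cst//.
by apply: ge0_le_integral => // y _; case/andP: (Fb y).
Qed.

Lemma potential_le m n F z : (\sum_(k < m) (t k)%:num <= 1)%R ->
  (forall y, 0 <= F y <= 1) -> measurable_fun setT F ->
  potential m n F z <= n%:R%:E.
Proof.
move=> t1 F1 mF; elim: n z => [|n IH] z //=.
have F0 y : 0 <= F y by case/andP: (F1 y).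
rewrite -natr1 (addrC n%:R)%R EFinD; apply: leeD; first by case/andP: (F1 z).
apply: (@le_trans _ _ ((\sum_(k < m) (t k)%:num)%R%:E * n%:R%:E)).
  apply: mixture_le_cst; last exact: measurable_potential.
  by move=> y; rewrite potential_ge0//= IH.
by rewrite -EFinM lee_fin ler_piMl.
Qed.

(** Countable additivity of the operators, so that the potential of the tail of
    the excesses can be estimated term by term. *)
Lemma mixture_series m N (g : nat -> T -> \bar R) z :
  (forall k y, 0 <= g k y) -> (forall k, measurable_fun setT (g k)) ->
  mixture m (tail_mean N g) z =
  \sum_(N <= k <oo) (t k)%:num%:E * mixture m (g k) z.
Proof.
move=> g0 mg; rewrite /mixture /tail_mean.
have wg0 k y : 0 <= (t k)%:num%:E * g k y.
  by apply: mule_ge0 => //; rewrite lee_fin.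
under eq_eseriesr.
  move=> k _; rewrite ge0_sume_distrr; last first.
    move=> i _; apply: mule_ge0; first by rewrite lee_fin.
    by apply: integral_ge0 => y _.
  over.
rewrite nneseries_sum; last first.
  move=> i k _; do 2 (apply: mule_ge0; first by rewrite lee_fin).
  by apply: integral_ge0 => y _.
apply: eq_bigr => i _.
under [RHS]eq_eseriesr do rewrite muleCA.
rewrite nneseriesZl; last first.
  move=> k _; apply: mule_ge0; first by rewrite lee_fin.
  by apply: integral_ge0 => y _.
congr (_ * _).
under eq_integral do rewrite -nneseries_addn//.
rewrite integral_nneseries//; last first.
  by move=> k; exact: measurable_funeM.
rewrite -(@nneseries_addn _ (fun k => (t k)%:num%:E * \int[K i z]_y g k y)).
  apply: eq_eseriesr => k _; rewrite ge0_integralZl//.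
move=> k; apply: mule_ge0; first by rewrite lee_fin.
by apply: integral_ge0 => y _.
Qed.

Lemma potential_series m n N (g : nat -> T -> \bar R) z :
  (forall k y, 0 <= g k y) -> (forall k, measurable_fun setT (g k)) ->
  potential m n (tail_mean N g) z =
  \sum_(N <= k <oo) (t k)%:num%:E * potential m n (g k) z.
Proof.
move=> g0 mg; elim: n z => [|n IH] z /=.
  by rewrite eseries0// => k _ _; rewrite mule0.
rewrite (_ : potential m n _ =
    tail_mean N (fun k => potential m n (g k))); last exact/funext.
rewrite mixture_series//; last 2 first.
  by move=> k y; exact: potential_ge0.
  by move=> k; exact: measurable_potential.
rewrite -nneseriesD//; last 2 first.
  by move=> k _ _; apply: mule_ge0 => //; rewrite lee_fin.
  move=> k _ _; apply: mule_ge0; first by rewrite lee_fin.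
  by apply: mixture_ge0 => y; exact: potential_ge0.
apply: eq_eseriesr => k _; rewrite ge0_muleDr//.
by apply: mixture_ge0 => y; exact: potential_ge0.
Qed.

End mixture.

(** * Oscillation of harmonic functions *)

Section oscillation.
Context (R : realType) (d : measure_display) (T : measurableType d).
Variables (t : nat -> {nonneg R}) (K : nat -> T -> {measure set T -> \bar R}).
Hypothesis measurable_K :
  forall k E, measurable E -> measurable_fun setT (fun z => K k z E).
Hypothesis K_total : forall k z, K k z setT = 1.
(** X plays the role of a fibre and delta k of the excess of the k-th
    kernel. *)
Variables (X : set T) (delta : nat -> T -> \bar R).
Hypothesis mX : measurable X.
Hypothesis K_X : forall k z, X z -> K k z (~` X) = 0.
Hypothesis delta_ge0 : forall k z, 0 <= delta k z.
Hypothesis measurable_delta : forall k, measurable_fun setT (delta k).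

Let D m z := tail_mean t m delta z.

Lemma ge0_integral_concentrated k z (F : T -> \bar R) : X z ->
  (forall y, 0 <= F y) -> measurable_fun setT F ->
  \int[K k z]_y F y = \int[K k z]_(y in X) F y.
Proof.
move=> Xz F0 mF; rewrite [LHS](ge0_negligible_integral (N := ~` X))//.
- by rewrite setTD setCK.
- exact: measurableC.
- exact: K_X.
Qed.

Lemma mixture_mono m F1 F2 z : X z ->
  (forall y, 0 <= F1 y) -> (forall y, 0 <= F2 y) ->
  measurable_fun setT F1 -> measurable_fun setT F2 ->
  (forall y, X y -> F1 y <= F2 y) -> mixture t K m F1 z <= mixture t K m F2 z.
Proof.
move=> Xz F10 F20 mF1 mF2 F12; apply: lee_sum => k _.
apply: lee_wpmul2l; first by rewrite lee_fin.
rewrite !ge0_integral_concentrated//; apply: ge0_le_integral => //.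
- exact: measurable_funTS.
- exact: measurable_funTS.
Qed.

Lemma mixtureD m F1 F2 z :
  (forall y, 0 <= F1 y) -> (forall y, 0 <= F2 y) ->
  measurable_fun setT F1 -> measurable_fun setT F2 ->
  mixture t K m (fun y => F1 y + F2 y) z =
  mixture t K m F1 z + mixture t K m F2 z.
Proof.
move=> F10 F20 mF1 mF2; rewrite /mixture -big_split/=; apply: eq_bigr => k _.
by rewrite ge0_integralD// ge0_muleDr//; exact: integral_ge0.
Qed.

Lemma mixtureZ m (a : R) F z : (0 <= a)%R ->
  (forall y, 0 <= F y) -> measurable_fun setT F ->
  mixture t K m (fun y => a%:E * F y) z = a%:E * mixture t K m F z.
Proof.
move=> a0 F0 mF; rewrite /mixture ge0_sume_distrr; last first.
  by move=> k _; apply: mule_ge0; rewrite ?lee_fin//; exact: integral_ge0.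
by apply: eq_bigr => k _; rewrite ge0_integralZl// muleCA.
Qed.

Lemma mixture_cst m (c : \bar R) z : 0 <= c ->
  mixture t K m (cst c) z = (\sum_(k < m) (t k)%:num)%R%:E * c.
Proof.
move=> c0; rewrite /mixture -sumEFin ge0_sume_distrl; last first.
  by move=> k _; rewrite lee_fin.
by apply: eq_bigr => k _; rewrite integral_cst// K_total mule1.
Qed.

Variables (v : T -> \bar R) (B : R) (c : nat -> \bar R).
Hypothesis B_ge0 : (0 <= B)%R.
Hypothesis v_bounds : forall z, 0 <= v z <= B%:E.
Hypothesis measurable_v : measurable_fun setT v.
Hypothesis c_ge0 : forall k, 0 <= c k.
Hypothesis v_harmonic : forall z, X z ->
  v z = \sum_(k <oo) (t k)%:num%:E * \int[K k z]_y v y.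
Hypothesis v_le_c : forall k z, X z ->
  \int[K k z]_y v y <= c k + B%:E * delta k z.
Hypothesis c_le_v : forall k z, X z ->
  c k <= \int[K k z]_y v y + B%:E * delta k z.

(** Both bounds pass from n to n + 1 by writing v = Qv + Tv, applying Q to the
    bounds for n, and replacing Tv by the constant C = sum_(k >= m) t_k c_k.
    The new constant is C + tau L. *)
Lemma oscillation_bound m n : exists L : \bar R,
  [/\ 0 <= L,
      forall z, X z -> v z <= (B * (\sum_(k < m) (t k)%:num) ^+ n)%R%:E + L
                              + B%:E * potential t K m n (D m) z &
      forall z, X z -> L <= v z + B%:E * potential t K m n (D m) z].
Proof.
have v0 z : 0 <= v z by case/andP: (v_bounds z).
have Kv0 k z : 0 <= \int[K k z]_y v y by exact: integral_ge0.
have tE k : 0 <= (t k)%:num%:E :> \bar R by rewrite lee_fin.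
have BE : 0 <= B%:E by rewrite lee_fin.
set tau := (\sum_(k < m) (t k)%:num)%R.
have tau0 : (0 <= tau)%R by apply: sumr_ge0.
have vE z : X z -> v z = mixture t K m v z +
    \sum_(m <= k <oo) (t k)%:num%:E * \int[K k z]_y v y.
  move=> Xz; rewrite {1}v_harmonic// (nneseries_split _ m)//; last first.
    by move=> k _; exact: mule_ge0.
  by rewrite add0n big_mkord.
pose C := \sum_(m <= k <oo) (t k)%:num%:E * c k.
have C0 : 0 <= C by apply: nneseries_ge0 => k _ _; exact: mule_ge0.
have BD z : B%:E * D m z = \sum_(m <= k <oo) (t k)%:num%:E * (B%:E * delta k z).
  rewrite /D /tail_mean -nneseriesZl; last by move=> k _; exact: mule_ge0.
  by apply: eq_eseriesr => k _; rewrite muleCA.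
have tailv z : X z -> \sum_(m <= k <oo) (t k)%:num%:E * \int[K k z]_y v y <=
    C + B%:E * D m z.
  move=> Xz; rewrite BD -nneseriesD; last 2 first.
    by move=> k _ _; exact: mule_ge0.
    by move=> k _ _; rewrite !mule_ge0.
  apply: lee_nneseries => [k _ _|k _]; first exact: mule_ge0.
  rewrite -ge0_muleDr//; last by rewrite mule_ge0.
  by apply: lee_wpmul2l => //; exact: v_le_c.
have tailc z : X z -> C <= \sum_(m <= k <oo) (t k)%:num%:E * \int[K k z]_y v y +
    B%:E * D m z.
  move=> Xz; rewrite BD -nneseriesD; last 2 first.
    by move=> k _ _; exact: mule_ge0.
    by move=> k _ _; rewrite !mule_ge0.
  apply: lee_nneseries => [k _ _|k _]; first exact: mule_ge0.
  rewrite -ge0_muleDr//; last by rewrite mule_ge0.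
  by apply: lee_wpmul2l => //; exact: c_le_v.
have U0 n' y : 0 <= potential t K m n' (D m) y.
  by apply: potential_ge0; exact: tail_mean_ge0.
have mU n' : measurable_fun setT (potential t K m n' (D m)).
  apply: measurable_potential => //; first exact: tail_mean_ge0.
  exact: measurable_tail_mean.
have D0 z : 0 <= D m z by exact: tail_mean_ge0.
elim: n => [|n [L [L0 vL Lv]]].
  exists 0; split => // z Xz /=.
    by rewrite expr0 mulr1 adde0 mule0 adde0; case/andP: (v_bounds z).
  by rewrite mule0 adde0.
exists (C + tau%:E * L); split.
- by rewrite adde_ge0// mule_ge0// lee_fin.
- move=> z Xz /=.
  have Q : mixture t K m v z <= (B * tau ^+ n.+1)%R%:E + tau%:E * L +
      B%:E * mixture t K m (potential t K m n (D m)) z.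
    apply: (le_trans (mixture_mono m (F2 := fun y => ((B * tau ^+ n)%R%:E + L)
      + B%:E * potential t K m n (D m) y) Xz _ _ _ _ vL)) => //.
    - move=> y; rewrite !adde_ge0 ?mule_ge0//.
      by rewrite lee_fin mulr_ge0// exprn_ge0.
    - by apply: emeasurable_funD => //; exact: measurable_funeM.
    rewrite (mixtureD m (F1 := cst ((B * tau ^+ n)%R%:E + L)))//; last 3 first.
    - by move=> y; rewrite adde_ge0// lee_fin mulr_ge0// exprn_ge0.
    - by move=> y; rewrite mule_ge0.
    - exact: measurable_funeM.
    rewrite mixtureZ// mixture_cst; last first.
      by rewrite adde_ge0// lee_fin mulr_ge0// exprn_ge0.
    rewrite ge0_muleDr//; last by rewrite lee_fin mulr_ge0// exprn_ge0.
    by rewrite -EFinM exprS mulrCA.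
  rewrite vE// ge0_muleDr//; last exact: mixture_ge0.
  apply: (le_trans (leeD Q (tailv _ Xz))).
  rewrite le_eqVlt; apply/orP; left; apply/eqP.
  rewrite -!addeA; congr (_ + _).
  rewrite [RHS]addeCA; congr (_ + _).
  by rewrite [LHS]addeCA; congr (_ + _); rewrite addeC.
- move=> z Xz /=.
  have Q : tau%:E * L <= mixture t K m v z +
      B%:E * mixture t K m (potential t K m n (D m)) z.
    rewrite -(mixture_cst m z)// -mixtureZ// -mixtureD//; last 2 first.
    - by move=> y; rewrite mule_ge0.
    - exact: measurable_funeM.
    apply: mixture_mono => //.
    - by move=> y; rewrite adde_ge0// mule_ge0.
    - by apply: emeasurable_funD => //; exact: measurable_funeM.
  rewrite {1}vE// ge0_muleDr//; last exact: mixture_ge0.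
  apply: (le_trans (leeD (tailc _ Xz) Q)).
  rewrite le_eqVlt; apply/orP; left; apply/eqP.
  rewrite [in RHS](addeC (mixture _ _ _ _ _)) -!addeA; congr (_ + _).
  rewrite [LHS]addeCA; congr (_ + _).
Qed.

(** The constant L of [oscillation_bound] is eliminated between the two points,
    so it does not matter how it varies with m. *)
Lemma oscillation_limit (n : nat -> nat) z z' : X z -> X z' ->
  ((\sum_(k < m) (t k)%:num) ^+ n m)%R @[m --> \oo] --> (0 : R)%R ->
  potential t K m (n m) (D m) z @[m --> \oo] --> 0 ->
  potential t K m (n m) (D m) z' @[m --> \oo] --> 0 ->
  v z <= v z'.
Proof.
move=> Xz Xz' tau0 Uz Uz'.
have lim : (B * (\sum_(k < m) (t k)%:num) ^+ n m)%R%:E +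
    (v z' + B%:E * potential t K m (n m) (D m) z') +
    B%:E * potential t K m (n m) (D m) z @[m --> \oo] --> v z'.
  rewrite -[X in _ --> X]adde0 -[X in _ --> X + _]add0e.
  rewrite -[X in _ --> _ + X + _]adde0.
  have BU y : potential t K m (n m) (D m) y @[m --> \oo] --> 0 ->
      B%:E * potential t K m (n m) (D m) y @[m --> \oo] --> 0.
    by move=> Uy; rewrite -[X in _ --> X](mule0 B%:E); apply: cvgeZl.
  have vfin : v z' \is a fin_num.
    have /andP[v0 vB] := v_bounds z'.
    by rewrite ge0_fin_numE// (le_lt_trans vB)// ltry.
  apply: cvgeD; [by rewrite adde0 add0e fin_num_adde_defr| |exact: BU].
  apply: cvgeD; [by rewrite adde0 fin_num_adde_defr| |].
    rewrite -[X in _ --> X%:E](mulr0 B); apply: cvg_EFin; first by near=> x.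
    exact: cvgMr.
  by apply: cvgeD; [rewrite fin_num_adde_defr|exact: cvg_cst|exact: BU].
rewrite -(cvg_lim _ lim)//; apply: lime_ge; first by apply/cvg_ex; exists (v z').
apply: nearW => m; have [L [L0 vL Lv]] := oscillation_bound m (n m).
by apply: (le_trans (vL _ Xz)); rewrite leeD2r// leeD2l// Lv.
Unshelve. all: by end_near. Qed.

End oscillation.

(** * Choice of the subsequence *)

Lemma seq_dependent_choice (P : seq nat -> nat -> Prop) :
  (forall s, exists i, P s i) ->
  exists sigma : nat -> nat, forall k, P (mkseq sigma k) (sigma k).
Proof.
move=> /choice[f Pf].
pose hist := fix hist k :=
  if k is k'.+1 then rcons (hist k') (f (hist k')) else [::].
exists (fun k => f (hist k)) => k.
suff -> : mkseq (fun k => f (hist k)) k = hist k by [].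
by elim: k => // k IH; rewrite mkseqS IH.
Qed.

Lemma bounded_cvg_integral (R : realType) (d : measure_display)
  (T : measurableType d) (m : {measure set T -> \bar R})
  (D : set T) (g : nat -> T -> \bar R) (b : R) :
  measurable D -> m D < +oo ->
  (forall k, measurable_fun setT (g k)) -> (forall k z, 0 <= g k z <= b%:E) ->
  {ae m, forall z, g k z @[k --> \oo] --> 0} ->
  \int[m]_(z in D) g k z @[k --> \oo] --> 0.
Proof.
move=> mD Doo mg gb g0.
have : [/\ m.-integrable D (cst 0 : T -> \bar R),
    [sequence \int[m]_(z in D) `|g k z - cst 0 z|]_k @ \oo --> 0 &
    [sequence \int[m]_(z in D) g k z]_k @ \oo --> \int[m]_(z in D) cst 0 z].
  apply: (@dominated_convergence _ _ _ m D mD g (cst 0) (cst b%:E)).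
  - by move=> k; exact: measurable_funTS.
  - exact: measurable_cst.
  - by apply: filterS g0 => z.
  - apply/integrableP; split; first exact: measurable_cst.
    by rewrite /= integral_cst// lte_mul_pinfty// ?lee_fin ?normr_ge0.
  - by apply: aeW => z k _ /=; case/andP: (gb k z) => g1 g2; rewrite gee0_abs.
by case=> _ _; rewrite integral0.
Qed.

Section almost_everywhere.
Context (R : realType) (d : measure_display) (T : measurableType d).
Variable m : {measure set T -> \bar R}.

Variable C : nat -> set T.
Hypothesis mC : forall p, measurable (C p).
Hypothesis ndC : forall p q, (p <= q)%N -> C p `<=` C q.
Hypothesis C_cover : \bigcup_p C p = setT.

(** From p on, the integrals over C p are dominated by a summable sequence, so
    that the series of the g k converges almost everywhere on C p. *)
Lemma summable_integrals_ae_cvg0 (e : nat -> R) (g : nat -> T -> \bar R) :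
  \sum_(k <oo) (e k)%:E < +oo -> (forall k, 0 <= e k)%R ->
  (forall k, measurable_fun setT (g k)) -> (forall k z, 0 <= g k z) ->
  (forall k, \int[m]_(z in C k) g k z <= (e k)%:E) ->
  {ae m, forall z, g k z @[k --> \oo] --> 0}.
Proof.
move=> eoo e0 mg g0 ge.
have eE k : 0 <= (e k)%:E by rewrite lee_fin.
have key p : {ae m, forall z, C p z -> \sum_(k <oo) g (k + p)%N z \is a fin_num}.
  apply: integrable_ae => //; apply/integrableP; split.
    apply: ge0_emeasurable_sum => // k _; exact: measurable_funTS.
  under eq_integral.
    move=> z _; rewrite gee0_abs; last by apply: nneseries_ge0 => k _ _.
    over.
  rewrite integral_nneseries//; last by move=> k; exact: measurable_funTS.
  apply: le_lt_trans eoo; apply: (@le_trans _ _ (\sum_(k <oo) (e (k + p)%N)%:E)).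
    apply: lee_nneseries => [k _ _|k _]; first exact: integral_ge0.
    apply: le_trans (ge _); apply: ge0_subset_integral => //.
      exact: measurable_funTS.
    by apply: ndC; rewrite leq_addl.
  rewrite (@nneseries_addn _ (fun k => (e k)%:E))//.
  rewrite [leRHS](nneseries_split _ p)// add0n leeDr//.
  by apply: sume_ge0.
have := @ae_foralln _ _ _ m _ key.
apply: filterS => z Cfin.
have [p _ Cpz] : (\bigcup_p C p) z by rewrite C_cover.
have {Cfin} Sfin := Cfin p Cpz.
rewrite -(cvg_shiftn p).
have tl : \sum_(N <= k <oo) g (k + p)%N z @[N --> \oo] --> 0.
  apply: nneseries_tail_cvg => //.
  by rewrite -ge0_fin_numE//; apply: nneseries_ge0 => k _ _.
apply: squeeze_cvge (cvg_cst 0) tl; apply: nearW => N /=; rewrite g0/=.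
have := @nneseries_lim_ge R (fun k => g (k + p)%N z) xpredT N N.+1.
by rewrite big_nat1; apply => k _ _.
Qed.

Variables (t : nat -> {nonneg R}) (K : nat -> T -> {measure set T -> \bar R}).
Hypothesis measurable_K :
  forall k E, measurable E -> measurable_fun setT (fun z => K k z E).
Hypothesis K_total : forall k z, K k z setT = 1.
Hypothesis K_nonsingular : forall k N, measurable N -> m N = 0 ->
  {ae m, forall z, K k z N = 0}.
Hypothesis t_gt0 : forall k, (0 < (t k)%:num)%R.
Hypothesis t_sum : \sum_(k <oo) (t k)%:num%:E <= 1.

Let measurable_Kidx (idx : nat -> nat) k E : measurable E ->
  measurable_fun setT (fun z => K (idx k) z E).
Proof. exact: measurable_K. Qed.

Let K_total_idx (idx : nat -> nat) k z : K (idx k) z setT = 1.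
Proof. exact: K_total. Qed.

Lemma partial_weight_le1 p : (\sum_(k < p) (t k)%:num <= 1)%R.
Proof.
rewrite -lee_fin; apply: le_trans t_sum.
rewrite -sumEFin -(big_mkord xpredT (fun k => (t k)%:num%:E)).
by apply: nneseries_lim_ge => k _ _; rewrite lee_fin.
Qed.

(** If g tends to 0 off a null set N, then for almost every z it does so off a
    K j z-null set, and bounded convergence applies to the measure K j z. *)
Lemma potential_ae_cvg0 (idx : nat -> nat) p n (g : nat -> T -> \bar R) :
  (forall k, measurable_fun setT (g k)) -> (forall k z, 0 <= g k z <= 1) ->
  {ae m, forall z, g k z @[k --> \oo] --> 0} ->
  {ae m, forall z,
    potential t (fun j => K (idx j)) p n (g k) z @[k --> \oo] --> 0}.
Proof.
move=> mg g1 g0.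
have gge0 k z : 0 <= g k z by case/andP: (g1 k z).
elim: n => [|n IH] /=; first by apply: aeW => z; exact: cvg_cst.
have [N [mN N0 subN]] := IH.
have KN j : {ae m, forall z, K j z N = 0} by exact: K_nonsingular.
have {}KN := @ae_foralln _ _ _ m _ KN.
apply: filterS2 g0 KN => z gz0 KN.
rewrite -[X in _ --> X]adde0; apply: cvgeD => //.
rewrite (_ : 0 = \sum_(j < p) (0 : \bar R)); last by rewrite big1.
apply: cvg_nnesum => [j _|j _].
  apply: nearW => k; apply: mule_ge0; first by rewrite lee_fin.
  by apply: integral_ge0 => y _; exact: potential_ge0.
rewrite -[X in _ --> X](mule0 ((t j)%:num%:E)); apply: cvgeZl => //.
apply: (@bounded_cvg_integral _ _ _ (K (idx j) z) setT _ n%:R) => //.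
- by rewrite K_total ltry.
- move=> k; apply: (measurable_potential t (measurable_Kidx idx)) => //.
- move=> k y; rewrite potential_ge0//=.
  apply: (potential_le (measurable_Kidx idx) (K_total_idx idx)) => //.
  exact: partial_weight_le1.
- by exists N; split.
Qed.

Lemma potential_ext (K1 K2 : nat -> T -> {measure set T -> \bar R}) p n F :
  (forall j, (j < p)%N -> K1 j = K2 j) ->
  potential t K1 p n F = potential t K2 p n F.
Proof.
move=> K12; elim: n => //= n ->; apply/funext => z; congr (_ + _).
by apply: eq_bigr => j _; rewrite K12.
Qed.

(** The potential with index p involves only the kernels sigma_j with j < p.
    Given sigma_0, ..., sigma_(k-1), the potentials of delta_i with index p <= k
    have integrals over C k that tend to 0 as i grows along a subsequence, so
    that sigma_k = i can be chosen to make these integrals at most t p.  Then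
    the potential of the whole tail has integral at most
    sum_(k >= p) t_k t_p <= t_p over C p, which is summable. *)
Theorem potential_selection (delta : nat -> T -> \bar R) (n : nat -> nat) :
  (forall p, m (C p) < +oo) ->
  (forall k, measurable_fun setT (delta k)) ->
  (forall k z, 0 <= delta k z <= 1) ->
  (forall p, \int[m]_(z in C p) delta k z @[k --> \oo] --> 0) ->
  exists sigma : nat -> nat, {ae m, forall z,
    potential t (fun j => K (sigma j)) p (n p)
      (tail_mean t p (fun j => delta (sigma j))) z @[p --> \oo] --> 0}.
Proof.
move=> Coo mdelta delta1 delta_cvg.
have delta0 k z : 0 <= delta k z by case/andP: (delta1 k z).
have tE k : 0 < (t k)%:num%:E :> \bar R by rewrite lte_fin.
have small (f : nat -> \bar R) p : (forall k, 0 <= f k) ->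
    f k @[k --> \oo] --> 0 -> \forall k \near \oo, f k <= (t p)%:num%:E.
  move=> f0 /fine_cvgP[ffin /cvgrPdist_le/(_ _ (t_gt0 p))] fp.
  near=> k; rewrite -[f k]fineK; last by near: k.
  have : (`|0 - fine (f k)| <= (t p)%:num)%R by near: k.
  by rewrite sub0r normrN ger0_norm ?lee_fin// fine_ge0.
have t_oo : \sum_(k <oo) (t k)%:num%:E < +oo by rewrite (le_lt_trans t_sum)// ltry.
(* A first subsequence rho, along which delta tends to 0 almost everywhere. *)
have /choice[rho rhoP] p : exists i : nat,
    \int[m]_(z in C p) delta i z <= (t p)%:num%:E.
  have [|N _ Np] := small _ p _ (delta_cvg p); first by move=> k; exact: integral_ge0.
  by exists N; apply: Np => /=.
have delta_ae : {ae m, forall z, delta (rho k) z @[k --> \oo] --> 0}.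
  by apply: (summable_integrals_ae_cvg0 t_oo).
pose Kr s j := K (rho (nth 0%N s j)).
have [tau tauP] : exists tau : nat -> nat, forall k (p : 'I_k.+1),
    \int[m]_(z in C k) potential t (fun j => K (rho (tau j))) p (n p)
      (delta (rho (tau k))) z <= (t p)%:num%:E.
  have [|tau tauP] := @seq_dependent_choice (fun s i => forall p : 'I_(size s).+1,
      \int[m]_(z in C (size s)) potential t (Kr s) p (n p) (delta (rho i)) z
        <= (t p)%:num%:E).
    move=> s.
    have : \forall i \near \oo, forall p : 'I_(size s).+1,
        \int[m]_(z in C (size s)) potential t (Kr s) p (n p) (delta (rho i)) z
        <= (t p)%:num%:E.
      apply: filter_forall => p; apply: small.
        by move=> k; apply: integral_ge0 => z _; exact: potential_ge0.
      apply: (@bounded_cvg_integral _ _ _ _ _ _ (n p)%:R) => //.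
      - move=> k; exact: (measurable_potential t
          (measurable_Kidx (fun j => rho (nth 0%N s j)))).
      - move=> k z; rewrite potential_ge0//=.
        apply: (potential_le (measurable_Kidx (fun j => rho (nth 0%N s j)))
          (K_total_idx _)) => //.
        exact: partial_weight_le1.
      - exact: (potential_ae_cvg0 (fun j => rho (nth 0%N s j))).
    by case=> N _ NP; exists N; exact: NP (leqnn N).
  exists tau => k p; have := tauP k; rewrite size_mkseq => /(_ p).
  rewrite (@potential_ext (Kr (mkseq tau k)) (fun j => K (rho (tau j))))// => j jp.
  rewrite /Kr nth_mkseq//; apply: leq_trans jp _.
  by rewrite -ltnS.
exists (rho \o tau).
have mKs := measurable_Kidx (rho \o tau).
apply: (summable_integrals_ae_cvg0 t_oo) => //.
- move=> k; apply: (measurable_potential t mKs).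
    exact: tail_mean_ge0.
  exact: measurable_tail_mean.
- by move=> k z; apply: potential_ge0; exact: tail_mean_ge0.
move=> p; under eq_integral do rewrite (potential_series t mKs)//.
pose G k := potential t (fun j => K (rho (tau j))) p (n p) (delta (rho (tau k))).
have G0 k z : 0 <= G k z by exact: potential_ge0.
have mG k : measurable_fun setT (G k).
  exact: (measurable_potential t mKs).
have tG0 k z : 0 <= (t k)%:num%:E * G k z by rewrite mule_ge0// ltW.
rewrite (eq_integral (fun z => \sum_(k <oo)
    (t (k + p)%N)%:num%:E * G (k + p)%N z)); last first.
  move=> z _; rewrite -(@nneseries_addn _ (fun k => (t k)%:num%:E * G k z))//.
rewrite integral_nneseries//; last first.
  by move=> k; apply: measurable_funTS; exact: measurable_funeM.
apply: (@le_trans _ _ (\sum_(k <oo) (t p)%:num%:E * (t (k + p)%N)%:num%:E)).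
  apply: lee_nneseries => [k _ _|k _]; first exact: integral_ge0.
  rewrite ge0_integralZl//; last exact: measurable_funTS.
  rewrite muleC; apply: lee_wpmul2r; first exact: ltW.
  have pk : (p < (k + p).+1)%N by rewrite ltnS leq_addl.
  apply: le_trans (tauP _ (Ordinal pk)); apply: ge0_subset_integral => //.
    exact: measurable_funTS.
  by apply: ndC; rewrite leq_addl.
rewrite nneseriesZl; last by move=> k _; exact: ltW.
rewrite -[leRHS]mule1; apply: lee_wpmul2l; first exact: ltW.
apply: le_trans t_sum; rewrite (@nneseries_addn _ (fun k => (t k)%:num%:E)); last first.
  by move=> k; exact: ltW.
rewrite [leRHS](nneseries_split _ p); last by move=> k _; exact: ltW.
by rewrite add0n leeDr//; apply: sume_ge0 => k _; exact: ltW.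
Unshelve. all: by end_near. Qed.
End almost_everywhere.

(** * Translation of measures on a semigroupoid *)

Section left_translation.
Context (R : realType) (d0 d : measure_display).
Context (G0 : measurableType d0) (G : measurableType d).
Variable S : borel_semigroupoid R G0 G.

Lemma sys_measure_fiber (rho : borel_system R S) x E : measurable E ->
  rho x E = rho x (fiber S x `&` E).
Proof.
move=> mE; have mF := measurable_fiber S x; have mFC := measurableC mF.
rewrite -[in LHS](setIT E) -(setUv (fiber S x)) setIUr.
rewrite measureU//; last 3 first.
- exact: measurableI.
- exact: measurableI.
- by rewrite setIACA setICr setI0.
rewrite [X in _ + X](_ : _ = 0) ?adde0; first by rewrite setIC.
apply: (@subset_measure0 _ _ _ _ _ (~` fiber S x)) => //.
- exact: measurableI.
- exact: sys_fiber.
Qed.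

(** Left multiplication by z, made total by an arbitrary value outside the fibre
    on which it is meaningful: measures given by systems do not charge the
    complement, and push-forwards need a globally measurable map. *)
Definition left_translation (z e : G) : G :=
  if e \in fiber S (src S z) then comp_mor S z e else z.

Lemma measurable_left_translation z :
  measurable_fun setT (left_translation z).
Proof.
move=> _ E mE; rewrite setTI.
have mF := measurable_fiber S (src S z).
have [B mB BE] := bs_comp S mE.
rewrite (_ : _ @^-1` _ = (fiber S (src S z) `&` xsection B z) `|`
    (~` fiber S (src S z) `&` [set _ | E z])).
  apply: measurableU; first by apply: measurableI => //; exact: measurable_xsection.
  apply: measurableI; first exact: measurableC.
  have [Ez|nEz] := pselect (E z).
    by rewrite (_ : [set _ | _] = setT)//; apply/seteqP; split.
  by rewrite (_ : [set _ | _] = set0)//; apply/seteqP; split.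
have BP e : fiber S (src S z) e -> E (comp_mor S z e) <-> B (z, e).
  move=> ze; have cze : composable S (z, e) by rewrite /composable/= ze.
  split=> [Ee|Be].
    have : (composable S `&` (fun p => comp_mor S p.1 p.2) @^-1` E) (z, e) by [].
    by rewrite BE => -[].
  have : (composable S `&` B) (z, e) by [].
  by rewrite -BE => -[].
apply/seteqP; split=> e /=; rewrite /left_translation.
  case: ifPn; rewrite ?notin_setE ?inE => ze Ee; last by right.
  by left; split=> //; rewrite /xsection/= inE; exact/BP.
case=> -[ze]; first by rewrite /xsection/= inE mem_set// => /(BP _ ze).
by rewrite memNset.
Qed.

HB.instance Definition _ z := isMeasurableFun.Build _ _ _ _ (left_translation z)
  (measurable_left_translation z).

Section translated.
Variables (rho : borel_system R S) (z : G).

(** The translate of rho as a bundled measure; see [translatedE]. *)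
Definition translated : set G -> \bar R :=
  pushforward (rho (src S z)) (left_translation z).

Let translated0 : translated set0 = 0. Proof. exact: measure0. Qed.

Let translated_ge0 E : 0 <= translated E. Proof. exact: measure_ge0. Qed.

Let translated_sigma_additive : semi_sigma_additive translated.
Proof. exact: measure_semi_sigma_additive. Qed.

HB.instance Definition _ := isMeasure.Build _ _ _ translated
  translated0 translated_ge0 translated_sigma_additive.

Lemma translatedE E : measurable E -> translated E = translate S z (rho (src S z)) E.
Proof.
move=> mE; rewrite /translated /pushforward /translate.
have mF := measurable_fiber S (src S z).
have mp : measurable (left_translation z @^-1` E).
  by rewrite -[X in measurable X]setTI; exact: measurable_left_translation.
rewrite sys_measure_fiber//.
congr (rho _ _); apply/seteqP; split => e /=; rewrite /left_translation.
  by move=> [ze]; rewrite mem_set.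
by move=> [ze ?]; rewrite mem_set.
Qed.

Lemma ge0_integral_translated (F : G -> \bar R) : (forall e, 0 <= F e) ->
  measurable_fun setT F ->
  \int[translated]_e F e = \int[rho (src S z)]_e F (left_translation z e).
Proof.
move=> F0 mF; rewrite ge0_integral_pushforward//.
Qed.

Lemma translated_total : rho (src S z) setT = 1 -> translated setT = 1.
Proof. by rewrite /translated /pushforward preimage_setT. Qed.

End translated.
End left_translation.

Section adapted.
Context (R : realType) (d0 d : measure_display).
Context (G0 : measurableType d0) (G : measurableType d).
Variables (S : borel_semigroupoid R G0 G) (lam theta : borel_system R S).
Hypothesis lam_proper : proper_system lam.
Hypothesis theta_adapted : adapted_probability lam theta.

Lemma measurable_idm : measurable_fun setT (idm S).
Proof.
move=> _ E mE; rewrite setTI (bs_subspace S).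
by exists E => //; rewrite setTI.
Qed.

Lemma measurable_integral_lam (h : G * G -> \bar R) :
  (forall p, 0 <= h p) -> measurable_fun setT h ->
  measurable_fun setT (fun z => \int[lam (tgt S z)]_e h (z, e)).
Proof.
move=> h0 mh; have [A [mA ndA Acover Abound]] := lam_proper.
apply: (measurable_fun_integral_exhausted
  (kappa := fun z => lam (tgt S z)) (A := A)) => //.
- move=> E mE; apply: (measurableT_comp (sys_measurable lam mE)).
  exact: bs_tgt.
- by move=> n; have [M MP] := Abound n; exists M => x.
Qed.

(** One Borel function gives the densities of both z theta^(s z) and
    theta^(t z): the latter is the translate by the identity of t z. *)
Definition joint_density (D : G * G -> \bar R) : Prop :=
  [/\ measurable_fun setT D, forall p, 0 <= D p,
      (forall z E, measurable E ->
        translated theta z E = \int[lam (tgt S z)]_(e in E) D (z, e)) &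
      (forall z E, measurable E ->
        theta (tgt S z) E = \int[lam (tgt S z)]_(e in E) D (idm S (tgt S z), e))].

Lemma joint_density_exists : exists D, joint_density D.
Proof.
have [_ _ [D [mD D0 DE]]] := theta_adapted.
exists D; split => // [z E mE|z E mE]; first by rewrite translatedE// DE.
have := DE (idm S (tgt S z)) E mE; rewrite tgt_idm => <-.
rewrite -translatedE// /translated /pushforward src_idm.
have mp : measurable (left_translation S (idm S (tgt S z)) @^-1` E).
  by rewrite -[X in measurable X]setTI; exact: measurable_left_translation.
rewrite (sys_measure_fiber _ _ mE) (sys_measure_fiber _ _ mp); congr (theta _ _).
have idE e : fiber S (tgt S z) e -> left_translation S (idm S (tgt S z)) e = e.
  move=> ze; rewrite /left_translation src_idm mem_set//.
  by rewrite -{1}ze comp_idl.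
by apply/seteqP; split => e /= [ze]; rewrite idE.
Qed.

End adapted.

(** * Excess of a translated probability *)

Section density.
Context (R : realType) (d0 d : measure_display).
Context (G0 : measurableType d0) (G : measurableType d).
Variables (S : borel_semigroupoid R G0 G) (lam theta : borel_system R S).
Hypothesis lam_proper : proper_system lam.
Hypothesis theta_adapted : adapted_probability lam theta.
Variable D : G * G -> \bar R.
Hypothesis D_density : joint_density lam theta D.

Let theta_total x : theta x setT = 1. Proof. by case: theta_adapted. Qed.

Let translated_total1 z : translated theta z setT = 1.
Proof. exact: translated_total. Qed.

Let Dunit p := D (idm S (tgt S p.1), p.2).

Let mD : measurable_fun setT D. Proof. by case: D_density. Qed.
Let D0 p : 0 <= D p. Proof. by case: D_density. Qed.

Let mDunit : measurable_fun setT Dunit.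
Proof.
rewrite /Dunit; apply: (measurableT_comp mD).
apply: measurable_fun_pair => //.
apply: measurableT_comp; first exact: measurable_idm.
by apply: measurableT_comp => //; exact: bs_tgt.
Qed.

(** Its section at z is where the density of z theta^(s z) dominates that of
    theta^(t z). *)
Definition excess_set : set (G * G) :=
  [set p | D (idm S (tgt S p.1), p.2) <= D p].

Lemma measurable_excess_set : measurable excess_set.
Proof. by rewrite -[excess_set]setTI; exact: measurable_lee. Qed.

(** Half of the total variation norm of z theta^(s z) - theta^(t z). *)
Definition excess (z : G) : \bar R :=
  translated theta z (xsection excess_set z) -
  theta (tgt S z) (xsection excess_set z).

Let measurable_section_integral (h : G * G -> \bar R) (A : set (G * G)) :
  (forall p, 0 <= h p) -> measurable_fun setT h -> measurable A ->
  measurable_fun setT (fun z => \int[lam (tgt S z)]_(e in xsection A z) h (z, e)).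
Proof.
move=> h0 mh mA.
rewrite (_ : (fun z => _) = (fun z => \int[lam (tgt S z)]_e (h \_ A) (z, e))).
  apply: measurable_integral_lam => // [p|]; first exact: erestrict_ge0.
  by apply/(measurable_restrictT _ _).1 => //; exact: measurable_funTS.
apply/funext => z; rewrite integral_mkcond; apply: eq_integral => e _.
by rewrite !patchE mem_xsection.
Qed.

Lemma measurable_translated_xsection A : measurable A ->
  measurable_fun setT (fun z => translated theta z (xsection A z)).
Proof.
move=> mA; case: D_density => _ _ KE _.
rewrite (_ : (fun z => _) =
    (fun z => \int[lam (tgt S z)]_(e in xsection A z) D (z, e))).
  exact: measurable_section_integral.
by apply/funext => z; rewrite KE//; exact: measurable_xsection.
Qed.

Lemma measurable_translated E : measurable E ->
  measurable_fun setT (fun z => translated theta z E).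
Proof.
move=> mE; rewrite (_ : (fun z => _) =
    (fun z => translated theta z (xsection (setT `*` E) z))).
  by apply: measurable_translated_xsection; exact: measurableX.
by apply/funext => z; rewrite in_xsectionX// inE.
Qed.

Lemma measurable_excess : measurable_fun setT excess.
Proof.
have mH := measurable_excess_set.
apply: emeasurable_funB; first exact: measurable_translated_xsection.
case: D_density => _ _ _ TE.
rewrite (_ : (fun z => _) =
    (fun z => \int[lam (tgt S z)]_(e in xsection excess_set z) Dunit (z, e))).
  by apply: measurable_section_integral => // p; exact: D0.
by apply/funext => z; rewrite TE//; exact: measurable_xsection.
Qed.

(** The translates are absolutely continuous with respect to lambda^(t z), since
    they have a density. *)
Lemma translated_null z N : measurable N -> lam (tgt S z) N = 0 ->
  translated theta z N = 0.
Proof.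
move=> mN N0; case: D_density => _ _ KE _; rewrite KE//.
apply: null_set_integral => //; apply: measurable_funTS.
exact: (measurableT_comp mD).
Qed.

Lemma translated_fiberC z : translated theta z (~` fiber S (tgt S z)) = 0.
Proof.
apply: translated_null; last exact: sys_fiber.
by apply: measurableC; exact: measurable_fiber.
Qed.

Lemma theta_le_translated z E : measurable E -> E `<=` xsection excess_set z ->
  theta (tgt S z) E <= translated theta z E.
Proof.
move=> mE EH; case: D_density => _ _ KE TE; rewrite KE// TE//.
apply: ge0_le_integral => //.
- by apply: measurable_funTS; exact: (measurableT_comp mD).
- by apply: measurable_funTS; exact: (measurableT_comp mD).
- by move=> e /EH; rewrite /xsection/= inE.
Qed.

Lemma translated_le_theta z E : measurable E -> E `<=` ~` xsection excess_set z ->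
  translated theta z E <= theta (tgt S z) E.
Proof.
move=> mE EH; case: D_density => _ _ KE TE; rewrite KE// TE//.
apply: ge0_le_integral => //.
- by apply: measurable_funTS; exact: (measurableT_comp mD).
- by apply: measurable_funTS; exact: (measurableT_comp mD).
- by move=> e /EH; rewrite /xsection/= inE => /negP; rewrite -ltNge => /ltW.
Qed.

Let mHz z : measurable (xsection excess_set z).
Proof. by apply: measurable_xsection; exact: measurable_excess_set. Qed.

Let le1 (P : {measure set G -> \bar R}) E : P setT = 1 -> measurable E -> P E <= 1.
Proof. by move=> <- mE; apply: le_measure; rewrite ?inE. Qed.

Let lt_oo (P : {measure set G -> \bar R}) E :
  P setT = 1 -> measurable E -> P E < +oo.
Proof. by move=> P1 mE; rewrite (le_lt_trans (le1 P1 mE))// ltry. Qed.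

Let mHCz z : measurable (~` xsection excess_set z).
Proof. exact: measurableC. Qed.

Lemma excess_bounds z : 0 <= excess z <= 1.
Proof.
have Kfin : theta (tgt S z) (xsection excess_set z) \is a fin_num.
  rewrite ge0_fin_numE//; exact: lt_oo (theta_total (tgt S z)) (mHz z).
apply/andP; split.
  by rewrite /excess sube_ge0 ?Kfin// theta_le_translated.
rewrite /excess leeBlDr//; apply: (le_trans (le1 (translated_total1 z) (mHz z))).
by rewrite leeDl.
Qed.

Lemma integral_translated_le z (F : G -> \bar R) (B : R) :
  (forall e, 0 <= F e <= B%:E) -> measurable_fun setT F ->
  \int[translated theta z]_e F e <=
    \int[theta (tgt S z)]_e F e + B%:E * excess z.
Proof.
move=> FB mF; apply: integral_hahn_le => //.
- exact: lt_oo (translated_total1 z) (mHz z).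
- exact: lt_oo (theta_total (tgt S z)) (mHz z).
- by move=> E; exact: theta_le_translated.
- by move=> E; exact: translated_le_theta.
Qed.

(** For two probabilities P and Q, the excess of P over Q on H is that of Q over
    P on the complement of H. *)
Lemma integral_theta_le z (F : G -> \bar R) (B : R) :
  (forall e, 0 <= F e <= B%:E) -> measurable_fun setT F ->
  \int[theta (tgt S z)]_e F e <=
    \int[translated theta z]_e F e + B%:E * excess z.
Proof.
move=> FB mF.
have fin (P : {measure set G -> \bar R}) E : P setT = 1 -> measurable E ->
    P E \is a fin_num.
  by move=> P1 mE; rewrite ge0_fin_numE// (le_lt_trans (le1 P1 mE))// ltry.
have -> : excess z = theta (tgt S z) (~` xsection excess_set z) -
    translated theta z (~` xsection excess_set z).
  have C (P : {measure set G -> \bar R}) : P setT = 1 ->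
      P (~` xsection excess_set z) = 1 - P (xsection excess_set z).
    move=> P1; rewrite -P1 -(setUv (xsection excess_set z)) measureU//; last first.
      by rewrite setICr.
    by rewrite addeAC subee ?add0e// fin.
  rewrite (C _ (theta_total _)) (C _ (translated_total1 z)) /excess /=.
  have := fin _ _ (translated_total1 z) (mHz z).
  have := fin _ _ (theta_total (tgt S z)) (mHz z).
  move: (theta _ _) => b bfin /=.
  move: (translated _ _ _) => a afin.
  by rewrite -(fineK afin) -(fineK bfin) -!EFinN -!EFinD; congr (_%:E); lra.
apply: (@integral_hahn_le _ _ _ (theta (tgt S z)) (translated theta z)
  (~` xsection excess_set z)) => //.
- exact: lt_oo (theta_total (tgt S z)) (mHCz z).
- exact: lt_oo (translated_total1 z) (mHCz z).
- by move=> E; exact: translated_le_theta.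
- by move=> E; rewrite setCK; exact: theta_le_translated.
Qed.

End density.

(** * The translation defect and the Reiter condition *)

Local Open Scope complex_scope.

Section defect.
Context (R : realType) (d0 d : measure_display).
Context (G0 : measurableType d0) (G : measurableType d).
Variables (M : measure_semigroupoid R G0 G).
Variable theta : borel_system R M.
Hypothesis theta_adapted : adapted_probability (ms_lambda M) theta.
Variable D : G * G -> \bar R.
Hypothesis D_density : joint_density (ms_lambda M) theta D.

Let S : borel_semigroupoid R G0 G := M.

Let nu z E := theta (tgt S z) E - translate S z (theta (src S z)) E.

Let theta_total x : theta x setT = 1. Proof. by case: theta_adapted. Qed.

Let translated_total1 z : translated (S := S) theta z setT = 1.
Proof. exact: translated_total. Qed.

Lemma sum_measure_partition (P : {measure set G -> \bar R}) n (E : 'I_n -> set G) :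
  (forall i, measurable (E i)) -> trivIset setT E -> \bigcup_i E i = setT ->
  \sum_(i < n) P (E i) = P setT.
Proof.
move=> mE tE UE; rewrite -measure_semi_additive_ord//; last first.
  by apply: bigsetU_measurable => i _.
congr (P _); rewrite -UE -bigcup_seq; apply/seteqP; split => x [i _ Ex].
  by exists i.
by exists i => //=; rewrite mem_index_enum.
Qed.

Lemma total_variation_le2 z : total_variation_norm (nu z) <= 2%:E.
Proof.
apply: ge_ereal_sup => _ [n [E [mE tE UE ->]]].
apply: (@le_trans _ _ (\sum_(i < n)
    (theta (tgt S z) (E i) + translated (S := S) theta z (E i)))).
  apply: lee_sum => i _; rewrite /nu -translatedE//.
  by rewrite (le_trans (lee_abs_sub _ _))// !gee0_abs.
rewrite big_split/= !sum_measure_partition// theta_total /=.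
by rewrite [X in _ + X]translated_total1 -EFinD lee_fin.
Qed.

(** Tested on the partition into the excess set and its complement. *)
Lemma excess_le_total_variation z :
  excess (S := S) theta D z <= total_variation_norm (nu z).
Proof.
pose H := xsection (excess_set S D) z.
have mH : measurable H.
  by apply: measurable_xsection; exact: measurable_excess_set D_density.
have mHC := measurableC mH.
apply: (@le_trans _ _ (`|nu z H|)).
  have Kfin : translated (S := S) theta z H \is a fin_num.
    rewrite ge0_fin_numE// (@le_lt_trans _ _ 1) ?ltry//.
    by rewrite -(translated_total1 z); apply: le_measure; rewrite ?inE.
  by rewrite /nu -translatedE// -abseN fin_num_oppeB// addeC lee_abs.
pose E (i : 'I_2) := if i == ord0 then H else ~` H.
have mE i : measurable (E i) by rewrite /E; case: ifP.
apply: (@le_trans _ _ (\sum_(i < 2) `|nu z (E i)|)).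
  by rewrite big_ord_recl /= {1}/E eqxx leeDl// sume_ge0.
apply: ereal_sup_ubound; exists 2%N, E; split => //.
  apply/trivIsetP => -[[|[|//]] i2] [[|[|//]] j2] _ _ // _; rewrite /E /=.
    by rewrite setICr.
  by rewrite setICl.
apply/seteqP; split => // x _; have [Hx|nHx] := pselect (H x).
  by exists ord0.
by exists (lift ord0 ord0).
Qed.

Lemma excess_le_defect z :
  excess (S := S) theta D z <= (translation_defect theta z)%:E.
Proof.
have le2 := total_variation_le2 z; have gle := excess_le_total_variation z.
rewrite /translation_defect fineK// fin_numElt (le_lt_trans le2) ?ltry// andbT.
rewrite (lt_le_trans _ gle)//.
have /andP[g0 _] := excess_bounds theta_adapted D_density z.
exact: lt_le_trans g0.
Qed.

Lemma defect_bounds z : (0 <= translation_defect theta z <= 2)%R.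
Proof.
have le2 := total_variation_le2 z; have gle := excess_le_defect z.
have /andP[g0 _] := excess_bounds theta_adapted D_density z.
have d0' : (0 <= translation_defect theta z)%R by rewrite -lee_fin (le_trans g0).
rewrite d0' /=; apply: (@fine_le R (total_variation_norm (nu z)) 2%:E) => //.
rewrite fin_numElt (le_lt_trans le2) ?ltry// andbT.
rewrite (lt_le_trans _ (excess_le_total_variation z))//.
exact: lt_le_trans g0.
Qed.

End defect.

Section reiter_excess.
Context (R : realType) (d0 d : measure_display).
Context (G0 : measurableType d0) (G : measurableType d).
Variables (M : measure_semigroupoid R G0 G).
Variable theta : nat -> borel_system R M.
Variable D : nat -> G * G -> \bar R.
Hypothesis theta_adapted : forall n, adapted_probability (ms_lambda M) (theta n).
Hypothesis D_density : forall n, joint_density (ms_lambda M) (theta n) (D n).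
Let m : {measure set G -> \bar R} := mstar (ms_mu M) (ms_lambda M).
Hypothesis theta_reiter : forall f : G -> R[i], cintegrable m setT f ->
  (fun n => cintegral m setT
     (fun g => ((translation_defect (theta n) g)%:C * f g)%R) : R[i]^o)
     @ \oo --> (0%R : R[i]^o).

(** Reiter's condition for the indicator function of C. *)
Lemma reiter_excess_cvg0 C : measurable C -> m C < +oo ->
  \int[m]_(z in C) excess (S := ms_semigroupoid M) (theta n) (D n) z
    @[n --> \oo] --> 0.
Proof.
move=> mC mCoo.
have int1 : m.-integrable setT (EFin \o \1_C).
  apply/integrableP; split; first by apply/measurable_EFinP.
  under eq_integral do rewrite /= ger0_norm//.
  by rewrite integral_indic// setIT.
have /theta_reiter : cintegrable m setT (fun g => (\1_C g)%:C).
  by split => //=; exact: integrable0.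
move=> /(@cvgrPdist_lt R[i] (R[i]^o)) H.
pose I n := \int[m]_g (translation_defect (theta n) g * \1_C g)%:E.
have dn n := defect_bounds (theta_adapted n) (D_density n).
have dn0 n g : (0 <= translation_defect (theta n) g * \1_C g)%R.
  by rewrite mulr_ge0//; case/andP: (dn n g).
have I_oo n : I n < +oo.
  apply: (@le_lt_trans _ _ (\int[m]_g (2 * \1_C g)%:E)).
    apply: ge0_le_integral_nonmeasurable => g; first by rewrite lee_fin.
    by rewrite lee_fin ler_wpM2r//; case/andP: (dn n g).
  under eq_integral do rewrite EFinM.
  rewrite ge0_integralZl//; last by apply/measurable_EFinP.
  by rewrite integral_indic// setIT lte_mul_pinfty.
have I_fin n : I n \is a fin_num.
  by rewrite ge0_fin_numE//; apply: integral_ge0 => g _; rewrite lee_fin.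
have excess_le n :
    \int[m]_(z in C) excess (S := ms_semigroupoid M) (theta n) (D n) z <= I n.
  rewrite integral_mkcond; apply: ge0_le_integral_nonmeasurable => g.
    apply: erestrict_ge0 => z _.
    by case/andP: (excess_bounds (theta_adapted n) (D_density n) z).
  rewrite patchE indicE; case: ifP => _; last by rewrite mulr0.
  by rewrite mulr1; exact: excess_le_defect.
have I_cvg : I n @[n --> \oo] --> 0.
  apply/fine_cvgP; split; first by apply: nearW.
  apply/cvgrPdist_lt => e e0; have /H : (0 < e%:C)%R by rewrite ltcR.
  apply: filterS => n; rewrite !sub0r !normrN => lte.
  rewrite -ltcR; apply: le_lt_trans lte.
  apply: le_trans (normc_ge_Re _); rewrite lecR /cintegral /=.
  rewrite /Rintegral /I.
  by under [in leRHS]eq_integral do rewrite mul0r subr0.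
apply: squeeze_cvge (cvg_cst 0) I_cvg; apply: nearW => n; rewrite excess_le andbT.
apply: integral_ge0 => z _.
by case/andP: (excess_bounds (theta_adapted n) (D_density n) z).
Qed.

End reiter_excess.

(** * The measure on morphisms *)

Section mstar_facts.
Context (R : realType) (d0 d : measure_display).
Context (G0 : measurableType d0) (G : measurableType d).
Variables (S : borel_semigroupoid R G0 G) (lam : borel_system R S).
Variable mu : {measure set G0 -> \bar R}.
Let m : {measure set G -> \bar R} := mstar mu lam.

Lemma mstar_ae0 N : measurable N -> m N = 0 -> {ae mu, forall x, lam x N = 0}.
Proof.
move=> mN mN0.
have : ae_eq mu setT (fun x => lam x N) (cst 0).
  apply/ae_eq_integral_abs => //; first exact: sys_measurable.
  by rewrite -[RHS]mN0; apply: eq_integral => x _; rewrite gee0_abs.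
by apply: filterS => x /(_ I).
Qed.

Lemma mstar_ae_fiber (P : G -> Prop) : {ae m, forall z, P z} ->
  {ae mu, forall x, {ae lam x, forall z, P z}}.
Proof.
move=> [N [mN N0 subN]].
by apply: filterS (mstar_ae0 mN N0) => x xN0; exists N; split.
Qed.

Lemma ae_mstar_tgt (P : G0 -> Prop) : {ae mu, forall x, P x} ->
  {ae m, forall z, P (tgt S z)}.
Proof.
move=> [N [mN N0 subN]].
have mtN : measurable (tgt S @^-1` N).
  by rewrite -[X in measurable X]setTI; exact: bs_tgt.
exists (tgt S @^-1` N); split => //; last by move=> z /= nP; exact: subN.
rewrite /m /= /mstar.
transitivity (\int[mu]_(x in N) lam x (tgt S @^-1` N)); last first.
  by apply: null_set_integral => //; apply: measurable_funTS; exact: sys_measurable.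
rewrite [RHS]integral_mkcond; apply: eq_integral => x _; rewrite patchE.
case: ifPn => //; rewrite notin_setE => Nx.
apply: (@subset_measure0 _ _ _ _ _ (~` fiber S x)) => //.
- by apply: measurableC; exact: measurable_fiber.
- by move=> z /= Nz tzx; apply: Nx; rewrite -tzx.
- exact: sys_fiber.
Qed.

(** Intersect the sets on which lambda is bounded with the preimages under the
    target map of sets of finite mu-measure. *)
Lemma mstar_exhaustion : proper_system lam -> sigma_finite setT mu ->
  exists C : nat -> set G,
    [/\ forall p, measurable (C p), forall p q, (p <= q)%N -> C p `<=` C q,
        \bigcup_p C p = setT & forall p, m (C p) < +oo].
Proof.
move=> [A [mA ndA Acover Abound]] /sigma_finiteP[B [Bcover ndB mB]].
have mtB p : measurable (tgt S @^-1` B p).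
  by rewrite -[X in measurable X]setTI; apply: bs_tgt => //; case: (mB p).
have {}ndA p q : (p <= q)%N -> A p `<=` A q.
  have /nondecreasing_seqP nd : forall n, (A n <= A n.+1)%O.
    by move=> n; exact/subsetPset.
  by move=> pq; apply/subsetPset; exact: nd.
exists (fun p => A p `&` tgt S @^-1` B p); split.
- by move=> p; exact: measurableI.
- move=> p q pq; apply: setISS; first exact: ndA.
  by apply: preimage_subset; apply/subsetPset; exact: ndB.
- apply/seteqP; split => // z _.
  have [p _ Ap] : (\bigcup_n A n) z by rewrite Acover.
  have [q _ Bq] : (\bigcup_n B n) (tgt S z) by rewrite -Bcover.
  exists (maxn p q) => //; split; first exact: ndA (leq_maxl _ _) _ Ap.
  have /subsetPset BB : (B q <= B (maxn p q))%O by apply: ndB; exact: leq_maxr.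
  exact: BB.
- move=> p; have [L LP] := Abound p; have [mBp Bpoo] := mB p.
  rewrite /m /= /mstar.
  apply: (@le_lt_trans _ _ (\int[mu]_(x in B p) L%:E)).
    rewrite [leRHS]integral_mkcond; apply: ge0_le_integral => //.
    - by apply: sys_measurable; exact: measurableI.
    - by apply/(measurable_restrictT _ _).1 => //; exact: measurable_cst.
    - move=> x _; rewrite patchE; case: ifPn => [_|]; last rewrite notin_setE => nBx.
        apply: le_trans (LP x); apply: le_measure; rewrite ?inE//.
        exact: measurableI.
      rewrite (@subset_measure0 _ _ _ _ _ (~` fiber S x))//.
      + exact: measurableI.
      + by apply: measurableC; exact: measurable_fiber.
      + by move=> z /= [_ Bz] tzx; apply: nBx; rewrite -tzx.
      + exact: sys_fiber.
  rewrite integral_cst//.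
  have [L0|L0] := leP 0%R L; first by rewrite lte_mul_pinfty.
  by rewrite (@le_lt_trans _ _ 0)// mule_le0_ge0// lee_fin ltW.
Qed.

End mstar_facts.

(** * Mixtures of adapted systems *)

Section mixed.
Context (R : realType) (d0 d : measure_display).
Context (G0 : measurableType d0) (G : measurableType d).
Variables (S : borel_semigroupoid R G0 G) (lam : borel_system R S).
Variables (t : nat -> {nonneg R}) (theta : nat -> borel_system R S).
Hypothesis t_sum : \sum_(k <oo) (t k)%:num%:E = 1.
Hypothesis theta_adapted : forall k, adapted_probability lam (theta k).

Definition mixed_measure (x : G0) : {measure set G -> \bar R} :=
  mseries (fun k => mscale (t k) (theta k x)) 0.

Lemma ge0_integral_mixed x (F : G -> \bar R) :
  (forall g, 0 <= F g) -> measurable_fun setT F ->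
  \int[mixed_measure x]_g F g =
  \sum_(k <oo) (t k)%:num%:E * \int[theta k x]_g F g.
Proof.
move=> F0 mF; rewrite ge0_integral_measure_series//.
by apply: eq_eseriesr => k _; rewrite ge0_integral_mscale.
Qed.

Lemma mixed_measureE x E :
  mixed_measure x E = \sum_(k <oo) (t k)%:num%:E * theta k x E.
Proof. by []. Qed.

Lemma mixed_measure_total x : mixed_measure x setT = 1.
Proof.
rewrite mixed_measureE -[RHS]t_sum; apply: eq_eseriesr => k _.
by have [-> _ _] := theta_adapted k; rewrite mule1.
Qed.

Lemma mixed_sigma_finite x : sigma_finite setT (mixed_measure x).
Proof.
exists (fun=> setT); first by rewrite bigcup_const.
by move=> _; split => //; rewrite mixed_measure_total ltry.
Qed.

Lemma mixed_fiber x : mixed_measure x (~` fiber S x) = 0.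
Proof.
by rewrite mixed_measureE eseries0// => k _ _; rewrite sys_fiber mule0.
Qed.

Lemma mixed_borel (f : G -> \bar R) : measurable_fun setT f ->
  (forall g, 0 <= f g) ->
  measurable_fun setT (fun x => \int[mixed_measure x]_g f g).
Proof.
move=> mf f0; under eq_fun do rewrite ge0_integral_mixed//.
apply: ge0_emeasurable_sum => [k x _ _|k _].
  by apply: mule_ge0; rewrite ?lee_fin//; exact: integral_ge0.
by apply: measurable_funeM; exact: sys_borel.
Qed.

Definition mixed_system : borel_system R S :=
  BorelSystem mixed_sigma_finite mixed_fiber mixed_borel.

Lemma mixed_adapted : adapted_probability lam mixed_system.
Proof.
split; first exact: mixed_measure_total.
  move=> x; apply/null_content_dominatesP => E mE E0 /=.
  rewrite mixed_measureE eseries0// => k _ _.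
  have [_ /(_ x)/null_content_dominatesP kx _] := theta_adapted k.
  by rewrite kx ?mule0.
have /choice[D DP] : forall k, exists D : G * G -> \bar R,
    [/\ measurable_fun setT D, forall p, 0 <= D p &
      forall g E, measurable E -> translate S g (theta k (src S g)) E =
        \int[lam (tgt S g)]_(e in E) D (g, e)].
  by move=> k; case: (theta_adapted k).
have D0 k p : 0 <= D k p by case: (DP k).
have mD k : measurable_fun setT (D k) by case: (DP k).
exists (fun p => \sum_(k <oo) (t k)%:num%:E * D k p); split.
- apply: ge0_emeasurable_sum => [k x _ _|k _]; first by rewrite mule_ge0// lee_fin.
  exact: measurable_funeM.
- by move=> p; apply: nneseries_ge0 => k _ _; rewrite mule_ge0// lee_fin.
move=> g E mE; rewrite integral_nneseries//; last 2 first.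
- move=> k; apply: measurable_funTS; apply: measurable_funeM.
  exact: (measurableT_comp (mD k)).
- by move=> k e _; rewrite mule_ge0// lee_fin.
apply: eq_eseriesr => k _; have [_ _ DE] := DP k.
rewrite ge0_integralZl// -?DE//.
  apply: measurable_funTS; exact: (measurableT_comp (mD k)).
Qed.

Lemma ge0_integral_translated_mixed z (F : G -> \bar R) :
  (forall g, 0 <= F g) -> measurable_fun setT F ->
  \int[translated mixed_system z]_g F g =
  \sum_(k <oo) (t k)%:num%:E * \int[translated (theta k) z]_g F g.
Proof.
move=> F0 mF; rewrite ge0_integral_translated// ge0_integral_mixed//.
  by apply: eq_eseriesr => k _; rewrite ge0_integral_translated.
apply: (measurableT_comp mF); exact: measurable_left_translation.
Qed.

End mixed.

(** * Harmonic functions on a fibre *)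

Section fiberwise.
Context (R : realType) (d0 d : measure_display).
Context (G0 : measurableType d0) (G : measurableType d).
Variables (S : borel_semigroupoid R G0 G) (lam pi : borel_system R S).
Hypothesis pi_adapted : adapted_probability lam pi.

Lemma ae_fiber x : {ae lam x, forall z, fiber S x z}.
Proof.
exists (~` fiber S x); split => //; last exact: sys_fiber.
by apply: measurableC; exact: measurable_fiber.
Qed.

(** A function defined lambda^x-almost everywhere on the fibre may be replaced by
    a globally measurable and bounded version inside the integrals that define
    the Markov operator, for every z of the fibre and not only for almost
    every z. *)
Lemma integral_comp_translated x z (u w : G -> R) (B : R) : fiber S x z ->
  measurable_fun (fiber S x) u -> measurable_fun setT w ->
  (forall e, `|w e| <= B)%R ->
  {ae lam x, forall e, u e = w e} ->
  \int[pi (src S z)]_(e in fiber S (src S z)) (u (comp_mor S z e))%:E =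
  \int[translated pi z]_e (w e)%:E.
Proof.
move=> xz mu mw wB [N [mN N0 subN]].
have [D D_density] := joint_density_exists pi_adapted.
have mphi := measurable_left_translation S z.
have mF := measurable_fiber S (src S z).
have pi1 : pi (src S z) setT = 1 by case: pi_adapted.
have phiE e : fiber S (src S z) e -> left_translation S z e = comp_mor S z e.
  by move=> ze; rewrite /left_translation mem_set.
have phiF e : fiber S (src S z) e -> fiber S x (left_translation S z e).
  move=> ze; rewrite phiE// /fiber/= tgt_comp//.
have mwphi : measurable_fun setT (fun e => w (left_translation S z e)).
  exact: measurableT_comp.
have mNphi : measurable (left_translation S z @^-1` N).
  by rewrite -[X in measurable X]setTI; exact: mphi.
have iw : (pi (src S z)).-integrable setT
    (EFin \o (fun e => w (left_translation S z e))).
  by apply: (@bounded_integrable _ _ _ _ _ B) => //; rewrite pi1 ltry.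
transitivity (\int[pi (src S z)]_(e in fiber S (src S z))
    (w (left_translation S z e))%:E).
  apply: ae_eq_integral => //.
  - apply/measurable_EFinP.
    apply: (eq_measurable_fun (fun e => u (left_translation S z e))).
      by move=> e /[!inE] ze; rewrite phiE.
    apply: (@measurable_comp _ _ _ _ _ _ (fiber S x)) => //.
    + exact: measurable_fiber.
    + by move=> _ [e ze <-]; exact: phiF.
    + exact: measurable_funTS.
  - by apply/measurable_EFinP; exact: measurable_funTS.
  exists (left_translation S z @^-1` N); split => //.
    have := translated_null D_density (z := z) mN.
    by rewrite xz /translated /pushforward; apply.
  move=> e /= nuw; apply: subN => /= uw; apply: nuw => ze.
  by rewrite -phiE// uw.
have mwE : measurable_fun setT (fun e => (w e)%:E) by apply/measurable_EFinP.
rewrite (integral_pushforward mphi (D := setT) mwE)//.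
rewrite [RHS](negligible_integral (N := ~` fiber S (src S z)))//.
- by rewrite preimage_setT setTD setCK.
- exact: measurableC.
- by rewrite preimage_setT.
- exact: sys_fiber.
Qed.

Lemma Rintegral_ae_constant x z (u : G -> R) (c : R) : fiber S x z ->
  measurable_fun (fiber S x) u -> {ae lam x, forall e, u e = c} ->
  (\int[pi (src S z)]_(e in fiber S (src S z)) u (comp_mor S z e))%R = c.
Proof.
move=> xz mu uc.
rewrite /Rintegral (integral_comp_translated (w := cst c) (B := `|c|) xz)//.
rewrite (eq_integral (cst c%:E))// integral_cst//=.
rewrite [X in _ * X]translated_total ?mule1//.
by case: pi_adapted.
Qed.

End fiberwise.

Section harmonic.
Context (R : realType) (d0 d : measure_display).
Context (G0 : measurableType d0) (G : measurableType d).
Variables (S : borel_semigroupoid R G0 G) (lam : borel_system R S).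
Variables (t : nat -> {nonneg R}) (theta : nat -> borel_system R S).
Hypothesis lam_proper : proper_system lam.
Hypothesis t_sum : \sum_(k <oo) (t k)%:num%:E = 1.
Hypothesis theta_adapted : forall k, adapted_probability lam (theta k).
Variable D : nat -> G * G -> \bar R.
Hypothesis D_density : forall k, joint_density lam (theta k) (D k).
Variable n : nat -> nat.
Hypothesis n_small :
  ((\sum_(k < m) (t k)%:num) ^+ n m)%R @[m --> \oo] --> (0 : R)%R.

Let pi := mixed_system t_sum theta_adapted.
Let U p z := potential t (fun k => translated (theta k)) p (n p)
  (tail_mean t p (fun k => excess (theta k) (D k))) z.

(** The equation Pu = u holds almost everywhere only.  But v = Pu is harmonic at
    every point of the fibre: v = u almost everywhere, and Pv only depends on
    the class of v because the translates of pi are absolutely continuous.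
    Adding the constant B makes all functions nonnegative. *)
Lemma harmonic_ae_constant x (u : G -> R) (B : R) : (0 <= B)%R ->
  {ae lam x, forall z, U p z @[p --> \oo] --> 0} ->
  measurable_fun (fiber S x) u -> {ae lam x, forall z, `|u z| <= B}%R ->
  {ae lam x, forall z,
    (\int[pi (src S z)]_(e in fiber S (src S z)) u (comp_mor S z e))%R = u z} ->
  exists c : R, {ae lam x, forall z, u z = c}.
Proof.
move=> B0 U0 mu uB uharm.
have pi_adapted : adapted_probability lam pi by exact: mixed_adapted.
have [Dpi Dpi_density] := joint_density_exists pi_adapted.
have mF := measurable_fiber S x.
(* w is a bounded version of u, and W is w shifted to be nonnegative. *)
pose A := fiber S x `&` u @^-1` `[(- B)%R, B].
have mA : measurable A by apply: mu => //; exact: measurable_itv.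
pose w := u \_ A.
have mw : measurable_fun setT w.
  by apply/(measurable_restrictT _ _).1 => //; apply: measurable_funS mu => // z [].
have wB z : (`|w z| <= B)%R.
  rewrite /w patchE; case: ifPn => [/[!inE]-[_ /=]|_]; last by rewrite normr0.
  by rewrite in_itv/= ler_norml.
have uw : {ae lam x, forall z, u z = w z}.
  apply: filterS2 (ae_fiber lam x) uB => z xz uz.
  by rewrite /w patchE mem_set//; split => //=; rewrite in_itv/= -ler_norml.
pose W z : \bar R := (w z + B)%:E.
have W_bounds z : 0 <= W z <= (2 * B)%:E.
  have := wB z; rewrite ler_norml => /andP[wl wr].
  by rewrite !lee_fin; apply/andP; split; lra.
have W0 z : 0 <= W z by case/andP: (W_bounds z).
have mW : measurable_fun setT W.
  by apply/measurable_EFinP; exact: measurable_funD.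
have pi1 z : translated pi z setT = 1.
  by apply: translated_total; case: pi_adapted.
have pifin z : translated pi z setT < +oo by rewrite pi1 ltry.
pose v z := \int[translated pi z]_e W e.
have v0 z : 0 <= v z by exact: integral_ge0.
have mv : measurable_fun setT v.
  apply: measurable_fun_integral_kernel => // E mE.
  exact: (measurable_translated lam_proper Dpi_density).
have v_bounds z : 0 <= v z <= (2 * B)%:E.
  rewrite v0/= -[leRHS]mule1 -(pi1 z) -integral_cst//.
  by apply: ge0_le_integral => // e _; case/andP: (W_bounds e).
have vW : {ae lam x, forall z, v z = W z}.
  apply: filterS3 (ae_fiber lam x) (uharm) (uw) => z xz.
  have iw : (translated pi z).-integrable setT (EFin \o w).
    exact: bounded_integrable (pifin z) mw wB.
  rewrite /Rintegral (integral_comp_translated pi_adapted xz mu mw wB uw) => uz uwz.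
  have {}uz : \int[translated pi z]_e (w e)%:E = (u z)%:E.
    by rewrite -uz fineK//; exact: integrable_fin_num iw.
  rewrite /v /W; under eq_integral do rewrite EFinD.
  rewrite integralD//; last first.
    apply: (bounded_integrable (f := cst B) (pifin z) _ (B := B)) => // e.
    by rewrite /= ger0_norm.
  by rewrite uz uwz integral_cst //= [X in _ * X]pi1 mule1 -EFinD.
have v_harmonic z : fiber S x z ->
    v z = \sum_(k <oo) (t k)%:num%:E * \int[translated (theta k) z]_e v e.
  move=> xz; rewrite -(ge0_integral_translated_mixed t_sum theta_adapted)//.
  apply: ge0_ae_eq_integral => //.
  have [N [mN N0 subN]] := vW; exists N; split => //.
    by apply: (translated_null Dpi_density) => //; rewrite xz.
  by move=> e /= nvW; apply: subN => /= ve; apply: nvW => _; rewrite ve.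
have theta1 k z : translated (theta k) z setT = 1.
  by apply: translated_total; case: (theta_adapted k).
have B2 : (0 <= 2 * B)%R by rewrite mulr_ge0.
have v_le z z' : fiber S x z -> fiber S x z' ->
    U p z @[p --> \oo] --> 0 -> U p z' @[p --> \oo] --> 0 -> v z <= v z'.
  move=> xz xz' Uz Uz'.
  apply: (@oscillation_limit _ _ _ t (fun k => translated (theta k)) _ _ (fiber S x)
    (fun k => excess (theta k) (D k)) _ _ _ _ v (2 * B)%R
    (fun k => \int[theta k x]_e v e) _ _ _ _ _ _ _ n z z') => //.
  - by move=> k E mE; exact: (measurable_translated lam_proper (D_density k)).
  - by move=> k y <-; exact: (translated_fiberC (D_density k)).
  - by move=> k y; case/andP: (excess_bounds (theta_adapted k) (D_density k) y).
  - by move=> k; exact: (measurable_excess lam_proper (D_density k)).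
  - by move=> k; exact: integral_ge0.
  - by move=> k y <-; exact: (integral_translated_le (theta_adapted k) (D_density k)).
  - by move=> k y <-; exact: (integral_theta_le (theta_adapted k) (D_density k)).
pose good z := [/\ fiber S x z, U p z @[p --> \oo] --> 0, v z = W z & u z = w z].
have goodE : {ae lam x, forall z, good z}.
  apply: filterS2 (ae_fiber lam x) (filterI U0 (filterI vW uw)).
  by move=> z xz [Uz [vz uz]].
have [[z0 [xz0 Uz0 vz0 uz0]]|nogood] := pselect (exists z, good z); last first.
  by exists 0%R; apply: filterS goodE => z gz; case: nogood; exists z.
exists (u z0); apply: filterS goodE => z [xz Uz vz uz].
have : v z = v z0 by apply/eqP; rewrite eq_le !v_le.
by rewrite vz vz0 uz uz0 => -[/addIr].
Qed.

End harmonic.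

(** * The Liouville property *)

Section weights.
Context (R : realType).

Definition dyadic_weight (k : nat) : {nonneg R} :=
  ((1 / (2 ^ (k + 1))%:R : R)%:nng)%R.

Lemma dyadic_weight_gt0 k : (0 < (dyadic_weight k)%:num)%R.
Proof. by rewrite /= divr_gt0// ltr0n expn_gt0. Qed.

Lemma dyadic_weight_sum : \sum_(k <oo) (dyadic_weight k)%:num%:E = 1.
Proof.
have := @cvg_geometric_eseries_half R 1%R 0%N; rewrite expr0 divr1.
by move/cvg_lim => /= <-.
Qed.

(** Each partial sum of the weights is less than 1, hence has a power below
    1 / (m + 1). *)
Lemma dyadic_exponents : exists n : nat -> nat,
  ((\sum_(k < m) (dyadic_weight k)%:num) ^+ n m)%R @[m --> \oo] --> (0 : R)%R.
Proof.
pose tau m := (\sum_(k < m) (dyadic_weight k)%:num)%R.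
have tau0 m : (0 <= tau m)%R by apply: sumr_ge0.
have tau1 m : (tau m < 1)%R.
  have : (tau m.+1 <= 1)%R by apply: partial_weight_le1; rewrite dyadic_weight_sum.
  by apply: lt_le_trans; rewrite /tau big_ord_recr ltrDl; exact: dyadic_weight_gt0.
have /choice[n nP] m : exists n, (tau m ^+ n <= m.+1%:R^-1)%R.
  have : (GRing.exp (tau m)) @ \oo --> (0 : R)%R.
    by apply: cvg_expr; rewrite ger0_norm.
  move=> /cvgrPdist_le/(_ (m.+1%:R^-1)%R _)[|N _ /(_ N (leqnn N))].
    by rewrite invr_gt0.
  by rewrite sub0r normrN ger0_norm ?exprn_ge0// => ?; exists N.
exists n; apply: (squeeze_cvgr _ (cvg_cst 0%R) cvg_harmonic).
by apply: nearW => m; apply/andP; split; [apply: exprn_ge0; exact: (tau0 m)|exact: nP].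
Qed.

End weights.

Lemma normc_ge_Im (R : rcfType) (z : R[i]) : (`|complex.Im z|%:C <= `|z|)%R.
Proof. by rewrite normc_def lecR -sqrtr_sqr ler_wsqrtr// lerDr sqr_ge0. Qed.

Theorem theorem5p3 (R : realType) (d0 d : measure_display)
    (G0 : measurableType d0) (G : measurableType d)
    (M : measure_semigroupoid R G0 G)
    (mu_sigma_finite : sigma_finite [set: G0] (ms_mu M)) :
  reiter M -> liouville M.
Proof.
move=> [theta [theta_adapted theta_reiter]].
pose S : borel_semigroupoid R G0 G := M.
pose lam : borel_system R S := ms_lambda M.
have lam_proper : proper_system lam by exact: ms_proper.
have /choice[D D_density] : forall k, exists Dk, joint_density lam (theta k) Dk.
  by move=> k; exact: joint_density_exists.
have [C [mC ndC C_cover Coo]] := mstar_exhaustion lam_proper mu_sigma_finite.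
have [n n_small] := dyadic_exponents R.
pose m : {measure set G -> \bar R} := mstar (ms_mu M) lam.
have [||||||||sigma U0] := @potential_selection _ _ _ m C mC ndC C_cover
  (@dyadic_weight R) (fun k => translated (S := S) (theta k)) _ _ _ _ _
  (fun k => excess (theta k) (D k)) n Coo.
- by move=> k E mE; exact: (measurable_translated lam_proper (D_density k)).
- by move=> k z; apply: translated_total; case: (theta_adapted k).
- move=> k N mN N0.
  have := ae_mstar_tgt lam (mstar_ae0 mN N0).
  by apply: filterS => z; exact: (translated_null (D_density k)).
- exact: dyadic_weight_gt0.
- by rewrite dyadic_weight_sum.
- by move=> k; exact: (measurable_excess lam_proper (D_density k)).
- by move=> k z; exact: (excess_bounds (theta_adapted k) (D_density k)).
- by move=> p; exact: (reiter_excess_cvg0 theta_adapted D_density theta_reiter).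
have sigma_adapted k : adapted_probability lam (theta (sigma k)) by [].
pose pi := mixed_system (dyadic_weight_sum R) sigma_adapted.
exists pi; split; first exact: mixed_adapted.
have := mstar_ae_fiber U0; apply: filterS => x {}U0.
have key (u : G -> R) (B : R) := harmonic_ae_constant (u := u)
  (t_sum := dyadic_weight_sum R) (theta_adapted := sigma_adapted) lam_proper
  (fun k => D_density (sigma k)) n_small (normr_ge0 B) U0.
have pi_adapted : adapted_probability lam pi by exact: mixed_adapted.
apply/seteqP; split => f [fL]; last first.
  move=> [c fc]; split => //; have [[mRe mIm] _] := fL.
  apply: filterS2 (ae_fiber lam x) (fc) => z xz ->.
  rewrite /markov_operator /cintegral.
  rewrite (Rintegral_ae_constant pi_adapted xz mRe (c := complex.Re c)); last first.
    by apply: filterS (fc) => e ->.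
  rewrite (Rintegral_ae_constant pi_adapted xz mIm (c := complex.Im c)); last first.
    by apply: filterS (fc) => e ->.
  by case: (c).
move=> fharm; split => //; have [[mRe mIm] [B fB]] := fL.
have bound (P : R[i] -> R) : (forall w, (`|P w|%:C <= `|w|)%R) ->
    {ae lam x, forall z, (`|P (f z)| <= `|B|)%R}.
  move=> Ple; apply: filterS fB => z fz; apply: le_trans (ler_norm B).
  by rewrite -lecR; exact: le_trans (Ple _) fz.
have [||a ra] := key (fun z => complex.Re (f z)) B mRe.
- exact: bound (@normc_ge_Re R).
- by apply: filterS (fharm) => z <-.
have [||b ib] := key (fun z => complex.Im (f z)) B mIm.
- exact: bound (@normc_ge_Im R).
- by apply: filterS (fharm) => z <-.
exists (a +i* b); apply: filterS2 ra ib => z.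
by case: (f z) => /= _ _ -> ->.
Qed.
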